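(* Let $\{\boldsymbol Z_n\}_{n\ge0}$ be a block lower Hessenberg branching process with type set $\mathcal{X}_d$, and let $A\subseteq\mathcal{X}_d$. If $\{\boldsymbol Z_n\}$ is irreducible, then $$\lim_{k\to\infty}\lim_{\ell\to\infty}\boldsymbol q^{(k,\ell)}(A)=\boldsymbol q(A).$$
   Context: Fix an integer $1\le d<\infty$ and let $\mathcal{X}_d=\{\langle k,i\rangle: k\ge 0,\ 1\le i\le d\}$ (type $\langle k,i\rangle$ is in level $k$), $\ell_k=\{\langle k,1\rangle,\dots,\langle k,d\rangle\}$, $T_k=\bigcup_{i=0}^k\ell_i$, $T_{-1}=\varnothing$; $\bar B=\mathcal{X}_d\setminus B$ denotes complement. A block lower Hessenberg branching process is a multitype Galton–Watson process $\{\boldsymbol Z_n\}_{n\ge0}$, $\boldsymbol Z_n=(Z_{n,j})_{j\in\mathcal{X}_d}$ (number of type-$j$ individuals in generation $n$), started from one individual of type $\varphi_0$, in which each individual lives one generation and, independently of all others, an individual of type $j$ produces offspring vector $\boldsymbol r=(r_l)_{l\in\mathcal{X}_d}$ with probability $p_j(\boldsymbol r)$, where for $j$ in level $k$ the distribution $p_j$ is concentrated on vectors with $r_l=0$ for all $l$ in levels larger than $k+1$. $G_j(\boldsymbol s)=\sum_{\boldsymbol r}p_j(\boldsymbol r)\prod_ls_l^{r_l}$, $\boldsymbol s\in[0,1]^{\mathcal{X}_d}$; $\mathbb P_i=\mathbb P(\cdot\mid\varphi_0=i)$. With $M(i,j)$ the expected number of type-$j$ children of a type-$i$ individual, the process is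 irreducible if in the directed graph on $\mathcal{X}_d$ with an edge $i\to j$ iff $M(i,j)>0$ there is a path between any two vertices. $q_i(A)=\mathbb P_i(\exists n:\sum_{m\ge n}\sum_{j\in A}Z_{m,j}=0)$ is the probability of eventual extinction in $A$, and $\boldsymbol q(A)=(q_i(A))_{i\in\mathcal{X}_d}$. For $k,\ell\ge-1$, $\boldsymbol q^{(k,\ell)}(A)$ is the extinction probability vector (the minimal solution in $[0,1]^{\mathcal{X}_d}$ of $\boldsymbol s=\boldsymbol G^{(k,\ell)}(A)(\boldsymbol s)$) of the modified process with progeny generating vector $$G_i^{(k,\ell)}(A)(\boldsymbol s)=\begin{cases}0,& i\in A\cap\bar T_k,\\ 1,& i\in\bar A\cap\bar T_\ell,\\ G_i(\boldsymbol s),&\text{otherwise.}\end{cases}$$ Thus types in $A\cap\bar T_k$ are immortal, types in $\bar A\cap\bar T_\ell$ are sterile, and $q_i^{(k,\ell)}(A)$ is the probability, starting from type $i$, that the process in which types outside $A\cup T_\ell$ are sterile becomes extinct before producing any type in $A\cap\bar T_k$.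
   Formalization: The set A is assumed nonempty, and if A is finite the process is assumed nonsingular (some type has, with positive probability, a total number of children different from one); without these the claim fails, e.g. for A empty or for a recurrent single-particle chain. *)

(* Defs.v *)
From HB Require Import structures.
From mathcomp Require Import all_boot all_order all_algebra finmap.
From mathcomp Require Import all_classical all_reals all_analysis.

Set Implicit Arguments.
Unset Strict Implicit.
Unset Printing Implicit Defensive.

Import Order.TTheory GRing.Theory Num.Theory.
Import numFieldNormedType.Exports.

Local Open Scope classical_set_scope.
Local Open Scope ring_scope.

(* [(k, i)] is the type <k, i+1>: the position inside a level is 0-based. *)
Notation typ d := (nat * 'I_d)%type.

(* An individual at level k has children in the finitely many types of levels
   at most k+1 only, so offspring vectors have finite support. *)
Notation offspring d := {fsfun typ d -> nat with 0%N}.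

Definition upto_level d (k : int) : set (typ d) := [set x | x.1%:Z <= k].
Arguments upto_level : clear implicits.

Section OffspringLaw.
Context {R : realType} {d : nat}.
Variable p : typ d -> offspring d -> R.

Record lower_hessenberg_law : Prop := LowerHessenbergLaw {
  law_ge0 : forall j r, 0 <= p j r ;
  law_sum1 : forall j, (\esum_(r in [set: offspring d]) (p j r)%:E = 1)%E ;
  law_hessenberg : forall j r l, p j r != 0 -> (j.1.+1 < l.1)%N -> r l = 0%N
}.

Definition mean_offspring (i j : typ d) : \bar R :=
  (\esum_(r in [set: offspring d]) (p i r * (r j)%:R)%:E)%E.

Definition irreducible_law : Prop :=
  forall i j : typ d, exists s : seq (typ d),
    path [rel x y | (0 < mean_offspring x y)%E] i s /\ last i s = j.

(* Excludes the degenerate case in which every individual has exactly one child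
   almost surely, so that the process is a single-particle Markov chain. *)
Definition nonsingular_law : Prop :=
  exists j r, p j r != 0 /\ (\sum_(l <- finsupp r) r l)%N <> 1%N.

Definition pgf (j : typ d) (s : typ d -> R) : R :=
  fine (\esum_(r in [set: offspring d])
          (p j r * \prod_(l <- finsupp r) s l ^+ r l)%:E)%E.

Definition modified_pgf (A : set (typ d)) (k l : int) (i : typ d)
    (s : typ d -> R) : R :=
  if `[< (A `&` ~` upto_level d k) i >] then 0
  else if `[< (~` A `&` ~` upto_level d l) i >] then 1
  else pgf i s.

End OffspringLaw.

Definition in_unit_cube {R : realType} {I : Type} (s : I -> R) : Prop :=
  forall i, 0 <= s i <= 1.

Definition minimal_solution {R : realType} {I : Type}
    (F : I -> (I -> R) -> R) (s : I -> R) : Prop :=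
  [/\ in_unit_cube s,
      (forall i, s i = F i s) &
      forall s', in_unit_cube s' -> (forall i, s' i = F i s') ->
        forall i, s i <= s' i].

(* The value 0 is never taken by default when [p] is a
   [lower_hessenberg_law]; see [modified_extinctionP]. *)
Definition modified_extinction {R : realType} {d : nat}
    (p : typ d -> offspring d -> R) (A : set (typ d)) (k l : int) :
    typ d -> R :=
  xget (fun=> 0) [set s | minimal_solution (modified_pgf p A k l) s].

Section Process.
Context {R : realType} {d : nat} {disp : measure_display}
  {Omega : measurableType disp}.
(* [P i] is the law of the process conditioned on the initial type being [i];
   [xi n j m w] is the offspring vector of the m-th individual of type j in
   generation n. *)
Variables (p : typ d -> offspring d -> R) (P : typ d -> probability Omega R)
  (phi0 : Omega -> typ d) (xi : nat -> typ d -> nat -> Omega -> offspring d).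

(* Types and offspring vectors form countable sets, so measurability, laws and
   mutual independence are expressed on singletons. *)
Record branching_process : Prop := BranchingProcess {
  phi0_measurable : forall i, measurable [set w | phi0 w = i] ;
  phi0_start : forall i, (P i [set w | phi0 w = i] = 1)%E ;
  xi_measurable : forall n j m r, measurable [set w | xi n j m w = r] ;
  xi_law : forall i n j m r, (P i [set w | xi n j m w = r] = (p j r)%:E)%E ;
  xi_independent : forall i (J : {fset nat * typ d * nat})
      (r : nat * typ d * nat -> offspring d),
    (P i (\bigcap_(u in [set` J]) [set w | xi u.1.1 u.1.2 u.2 w = r u]) =
     \prod_(u <- J) P i [set w | xi u.1.1 u.1.2 u.2 w = r u])%E
}.

(* The sum over [j] has finitely many nonzero terms, as every generation is
   finite. *)
Fixpoint generation (n : nat) (w : Omega) : typ d -> nat :=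
  match n with
  | 0 => fun l => (l == phi0 w : nat)
  | n.+1 => fun l =>
      \sum_(j \in [set: typ d]) \sum_(m < generation n w j) xi n j m w l
  end.

Definition extinction (A : set (typ d)) (i : typ d) : R :=
  fine (P i [set w | exists n : nat,
    (\sum_(n <= m <oo) \esum_(j in A) (generation m w j)%:R%:E = 0 :> \bar R)%E]).

End Process.

Section WellDefined.
Context {R : realType} {d : nat}.
Variable p : typ d -> offspring d -> R.
Hypothesis hp : lower_hessenberg_law p.

Lemma pgf_le j (s t : typ d -> R) : in_unit_cube s -> in_unit_cube t ->
  (forall i, s i <= t i) -> 0 <= pgf p j s /\ pgf p j s <= pgf p j t <= 1.
Proof.
move=> s01 t01 st.
have prod0 u (r : offspring d) : in_unit_cube u ->
    0 <= \prod_(l <- finsupp r) u l ^+ r l.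
  by move=> u01; apply: prodr_ge0 => l _; rewrite exprn_ge0//; case/andP: (u01 l).
have prod1 u (r : offspring d) : in_unit_cube u ->
    \prod_(l <- finsupp r) u l ^+ r l <= 1.
  move=> u01; apply: prodr_ile1 => l.
  by move: (u01 l) => /andP[? ?]; rewrite exprn_ge0 // exprn_ile1.
have term0 u (r : offspring d) : in_unit_cube u ->
    (0 <= (p j r * \prod_(l <- finsupp r) u l ^+ r l)%:E)%E.
  by move=> u01; rewrite lee_fin mulr_ge0 ?(law_ge0 hp)// prod0.
have esum1' u : in_unit_cube u -> (\esum_(r in [set: offspring d])
    (p j r * \prod_(l <- finsupp r) u l ^+ r l)%:E <= 1)%E.
  move=> u01; rewrite -(law_sum1 hp j); apply: le_esum => r _.
  by rewrite lee_fin ler_piMr ?(law_ge0 hp)// prod1.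
have esum0' u : in_unit_cube u -> (0 <= \esum_(r in [set: offspring d])
    (p j r * \prod_(l <- finsupp r) u l ^+ r l)%:E)%E.
  by move=> u01; apply: esum_ge0 => r _; exact: term0.
have fin u : in_unit_cube u -> (\esum_(r in [set: offspring d])
    (p j r * \prod_(l <- finsupp r) u l ^+ r l)%:E)%E \is a fin_num.
  move=> u01; rewrite ge0_fin_numE ?esum0'//.
  by apply: le_lt_trans (esum1' _ u01) _; rewrite ltry.
split; first by apply: fine_ge0; exact: esum0'.
apply/andP; split; last first.
  by rewrite -[leRHS]/(fine 1%E); apply: fine_le; rewrite ?fin ?esum1'.
apply: fine_le; rewrite ?fin//; apply: le_esum => r _.
rewrite lee_fin ler_wpM2l ?(law_ge0 hp)//.
apply: ler_prod => l _; move: (s01 l) => /andP[s0 _].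
by rewrite exprn_ge0//= lerXn2r ?nnegrE// (le_trans s0).
Qed.

Lemma modified_extinctionP (A : set (typ d)) (k l : int) :
  minimal_solution (modified_pgf p A k l) (modified_extinction p A k l).
Proof.
suff [s hs] : exists s, minimal_solution (modified_pgf p A k l) s.
  exact: (@xgetPex _ (fun=> 0) [set s | minimal_solution _ s]) (ex_intro _ s hs).
set F := modified_pgf p A k l.
have mono s t : in_unit_cube s -> in_unit_cube t -> (forall i, s i <= t i) ->
    forall i, 0 <= F i s /\ F i s <= F i t <= 1.
  move=> s01 t01 st i; rewrite /F /modified_pgf.
  case: ifP => _; first by rewrite !lexx /= ?ler01.
  by case: ifP => _; [rewrite !lexx ?ler01 | exact: pgf_le].
pose pre := [set s | in_unit_cube s /\ forall i, F i s <= s i].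
pose q i := inf [set s i | s in pre].
have cube1 : in_unit_cube (fun _ : typ d => 1 : R).
  by move=> i; rewrite ler01 /= lexx.
have pre1 : pre (fun=> 1).
  by split => // i; have [_ /andP[_ ->]] := mono _ _ cube1 cube1 (fun=> lexx _) i.
have lbq i : lbound [set s i | s in pre] 0.
  by move=> _ [s [s01 _] <-]; case/andP: (s01 i).
have qle s i : pre s -> q i <= s i.
  by move=> hs; apply: ge_inf; [exists 0; exact: lbq | exists s].
have leq i x : (forall s, pre s -> x <= s i) -> x <= q i.
  move=> h; apply: lb_le_inf; first by exists 1, (fun=> 1).
  by move=> _ [s hs <-]; exact: h.
have q01 : in_unit_cube q.
  move=> i; apply/andP; split; last exact: (qle (fun=> 1)).
  by apply: leq => s [s01 _]; case/andP: (s01 i).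
have Fq i : F i q <= q i.
  apply: leq => s hs; have [s01 sF] := hs.
  have [_ /andP[+ _]] := mono q s q01 s01 (fun j => qle s j hs) i.
  by move=> /le_trans; apply.
have preFq : pre (fun i => F i q).
  have F01 : in_unit_cube (fun i => F i q).
    move=> i; have [-> /andP[_ ->]//] := mono q q q01 q01 (fun=> lexx _) i.
  by split => // i; have [_ /andP[]] := mono _ _ F01 q01 Fq i.
exists q; split => //.
- by move=> i; apply/eqP; rewrite eq_le Fq (qle _ i preFq).
- by move=> s s01 sF i; apply: qle; split => // j; rewrite -sF.
Qed.

End WellDefined.

(* Main.v *)
Require Import Defs.
From HB Require Import structures.
From mathcomp Require Import all_boot all_order all_algebra finmap.
From mathcomp Require Import all_classical all_reals all_analysis.
From mathcomp Require Import ring lra.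

Set Implicit Arguments.
Unset Strict Implicit.
Unset Printing Implicit Defensive.

Import Order.TTheory GRing.Theory Num.Theory.
Import numFieldNormedType.Exports.

Local Open Scope classical_set_scope.
Local Open Scope ring_scope.

(** The generating function of type [j] is a power series with nonnegative
    coefficients in finitely many variables, hence monotone, continuous, and
    convex along increasing segments; the argument works with these alone.

    Let [u] be the vector of probabilities of never visiting [A]. Conditioning on
    the generations shows that [extinction = lim_n G^n(u)] =: [q].

    Lower bound. By irreducibility [u < 1], so [u <= h < 1] on the finite set
    [T_l]. Freeze the types of [A] (value [0]) and those above level [l] (value
    [u]), and let [K] be the resulting operator, whose greatest fixed point is
    [u]. Convexity applied to [u <= (1 - h) K(0) + h 1] gives, after iteration,
    [u <= (1 - h) lfp K + h u], so [u <= lfp K <= q^(k,l)]. A process started at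
    level [m] does not exceed level [m + n] within [n] generations, hence
    [G^n(u) <= q^(k,l)] at level [m] as soon as [m + n <= k].

    Upper bound. Let [r = lim_l q^(k,l)]. If [r <= h < 1] on [A], the same
    convexity gives [r <= (1 - h) q + h], and freezing the types above level [l]
    upgrades this to [r <= (1 - h) q + h q^(k,l)], so [r <= q] as [l] tends to
    infinity. The hypothesis holds by irreducibility unless [r = 1] and [A] is
    finite. In that case, if no individual ever has two children, positive death
    probability forces [q = 1]. Otherwise stop the process at a single [a] in [A]
    with value [w a], where [w] is the midpoint of [1] and
    [z = q({a})]; if [z < 1], strict convexity makes [G^n(w) < w] at [a] for some
    [n], whereas extinction of all truncations forces the opposite. *)

(** * Expectations of bounded functions under a discrete law *)

Lemma esum_scale {R : realType} {T : choiceType} (c : R) (a : T -> R) :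
  0 <= c -> (forall t, 0 <= a t) ->
  (\esum_(t in [set: T]) (c * a t)%:E =
   c%:E * \esum_(t in [set: T]) (a t)%:E)%E.
Proof.
have le (k : R) (b : T -> R) : 0 <= k -> (forall t, 0 <= b t) ->
    (\esum_(t in [set: T]) (k * b t)%:E <=
     k%:E * \esum_(t in [set: T]) (b t)%:E)%E.
  move=> k0 b0; apply: ge_ereal_sup => _ [X [finX _] <-].
  under eq_fsbigr do rewrite EFinM.
  rewrite -ge0_mule_fsumr; last by move=> t; rewrite lee_fin.
  rewrite lee_wpmul2l ?lee_fin//.
  by apply: ereal_sup_ubound; exists X.
move=> c0 a0; apply/eqP; rewrite eq_le le//=.
have [->|cneq0] := eqVneq c 0.
  by rewrite mul0e; apply: esum_ge0 => t _; rewrite mul0r.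
(* The reverse inequality is the first one applied to [c^-1] and [c * a]. *)
have ci0 : 0 <= c^-1 by rewrite invr_ge0.
have := le c^-1 (fun t => c * a t) ci0 (fun t => mulr_ge0 c0 (a0 t)).
under eq_esum do rewrite mulKf//.
move=> /(lee_wpmul2l (_ : (0 <= c%:E)%E)) => /(_ c0).
by rewrite muleA -EFinM divff// mul1e.
Qed.

Section WeightedMean.
Context {R : realType} {T : choiceType} (w : T -> R).
Hypothesis w_ge0 : forall t, 0 <= w t.
Hypothesis w_sum1 : (\esum_(t in [set: T]) (w t)%:E = 1)%E.
Implicit Types f g : T -> R.

(** Expectation under the law [w]. On functions satisfying [nonneg_bounded] the sum is finite
    ([wmean_fin]), so [fine] loses nothing. *)
Definition wmean f : R := fine (\esum_(t in [set: T]) (w t * f t)%:E)%E.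

Definition nonneg_bounded f := exists M, forall t, 0 <= f t <= M.

Let wf_ge0 f t : nonneg_bounded f -> (0 <= (w t * f t)%:E)%E.
Proof. by case=> M /(_ t)/andP[f0 _]; rewrite lee_fin mulr_ge0. Qed.

Lemma wmean_fin f : nonneg_bounded f ->
  (\esum_(t in [set: T]) (w t * f t)%:E)%E \is a fin_num.
Proof.
move=> bf; rewrite ge0_fin_numE; last by apply: esum_ge0 => t _; exact: wf_ge0.
have [M fM] := bf.
have [t0|Tempty] := pselect (exists t : T, True); last first.
  rewrite esum1 ?ltry// => t; exfalso; apply: Tempty; by exists t.
have M0 : 0 <= M by case: t0 => t _; have /andP[/le_trans] := fM t; apply.
apply: (@le_lt_trans _ _ (\esum_(t in [set: T]) (M * w t)%:E)%E).
  apply: le_esum => t _; rewrite lee_fin mulrC ler_wpM2r//.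
  by case/andP: (fM t).
by rewrite esum_scale// w_sum1 mule1 ltry.
Qed.

Lemma nonneg_boundedD f g : nonneg_bounded f -> nonneg_bounded g ->
  nonneg_bounded (fun t => f t + g t).
Proof.
move=> [M fM] [N gN]; exists (M + N) => t.
by have /andP[? ?] := fM t; have /andP[? ?] := gN t; rewrite addr_ge0//= lerD.
Qed.

Lemma nonneg_boundedZ c f : 0 <= c -> nonneg_bounded f ->
  nonneg_bounded (fun t => c * f t).
Proof.
move=> c0 [M fM]; exists (c * M) => t.
by have /andP[? ?] := fM t; rewrite mulr_ge0//= ler_wpM2l.
Qed.

Lemma wmeanD f g : nonneg_bounded f -> nonneg_bounded g ->
  wmean (fun t => f t + g t) = wmean f + wmean g.
Proof.
move=> bf bg; rewrite /wmean -fineD ?wmean_fin// -esumD; last 2 first.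
- by move=> t _; exact: wf_ge0.
- by move=> t _; exact: wf_ge0.
by congr fine; apply: eq_esum => t _; rewrite mulrDr EFinD.
Qed.

Lemma wmeanZ c f : 0 <= c -> nonneg_bounded f ->
  wmean (fun t => c * f t) = c * wmean f.
Proof.
move=> c0 bf; rewrite /wmean.
have -> : c * fine (\esum_(t in [set: T]) (w t * f t)%:E)%E =
   fine (c%:E * \esum_(t in [set: T]) (w t * f t)%:E)%E.
  by rewrite fineM// wmean_fin.
rewrite -esum_scale//; last by move=> t; have := wf_ge0 t bf; rewrite lee_fin.
by congr fine; apply: eq_esum => t _; rewrite mulrCA.
Qed.

Lemma le_wmean f g : nonneg_bounded f -> nonneg_bounded g ->
  (forall t, w t != 0 -> f t <= g t) -> wmean f <= wmean g.
Proof.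
move=> bf bg fg; apply: fine_le; rewrite ?wmean_fin//.
apply: le_esum => t _; rewrite lee_fin.
by have [->|/fg ?] := eqVneq (w t) 0; rewrite ?mul0r// ler_wpM2l.
Qed.

Lemma wmean_pred1 t0 : wmean (fun t => (t == t0)%:R) = w t0.
Proof.
rewrite /wmean (esumID [set t0])/= ?[X in (_ + X)%E]esum1 ?adde0; last 2 first.
- by move=> t [_ /= /eqP/negPf ->]; rewrite mulr0.
- by move=> t _; rewrite lee_fin mulr_ge0.
by rewrite setTI esum_set1 ?eqxx ?mulr1 ?lee_fin.
Qed.

Lemma nonneg_bounded_pred1 t0 : nonneg_bounded (fun t => (t == t0)%:R).
Proof. by exists 1 => t; rewrite ler0n/=; case: (_ == _); rewrite ?ler01. Qed.

(** Adding to [f] the gap at [t0], as a multiple of a point indicator, keeps it below [g] wherever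
    [w] is nonzero and raises its mean by a positive amount. *)
Lemma lt_wmean f g t0 : nonneg_bounded f -> nonneg_bounded g ->
  (forall t, w t != 0 -> f t <= g t) -> w t0 != 0 -> f t0 < g t0 ->
  wmean f < wmean g.
Proof.
move=> bf bg fg wt0 fgt0.
have b1 := nonneg_bounded_pred1 t0.
have gap0 : 0 < g t0 - f t0 by rewrite subr_gt0.
have bd : nonneg_bounded (fun t => (g t0 - f t0) * (t == t0)%:R).
  by apply: nonneg_boundedZ => //; exact: ltW.
apply: (@lt_le_trans _ _ (wmean (fun t => f t + (g t0 - f t0) * (t == t0)%:R))).
  rewrite wmeanD// ltrDl wmeanZ// ?(ltW gap0)// wmean_pred1 mulr_gt0//.
  by rewrite lt_neqAle eq_sym wt0 w_ge0.
apply: le_wmean => // [|t wt]; first exact: nonneg_boundedD.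
case: eqVneq => [->|_]; last by rewrite mulr0 addr0 fg.
by rewrite mulr1 addrC subrK.
Qed.

Lemma wmean_cst1 : wmean (fun=> 1) = 1.
Proof.
by rewrite /wmean; under eq_esum do rewrite mulr1; rewrite w_sum1.
Qed.

Lemma wmean_fset (X : set T) f : finite_set X -> nonneg_bounded f ->
  wmean (fun t => f t * (t \in X)%:R) = \sum_(t \in X) w t * f t.
Proof.
move=> finX bf; rewrite /wmean (esumID X)/= ?[X in (_ + X)%E]esum1 ?adde0; last 2 first.
- by move=> t [_ Xt]; rewrite memNset// !mulr0.
- move=> t _; rewrite lee_fin mulr_ge0// mulr_ge0//.
  by case: bf => M /(_ t)/andP[].
rewrite setTI esum_fset//; last first.
  move=> t _; rewrite lee_fin mulr_ge0// mulr_ge0//.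
  by case: bf => M /(_ t)/andP[].
rewrite -[RHS]/(fine (_)%:E) -fsumEFin//; congr fine; apply: eq_fsbigr => t tX.
by rewrite tX mulr1.
Qed.

(** Bounded convergence: a finite set [X] carries almost all the mass, and outside it every function
    bounded by [M] contributes little, uniformly. *)
Lemma cvg_wmean (f_ : nat -> T -> R) f M : (forall n t, 0 <= f_ n t <= M) ->
  (forall t, 0 <= f t <= M) ->
  (forall t, f_ n t @[n --> \oo] --> f t) ->
  wmean (f_ n) @[n --> \oo] --> wmean f.
Proof.
move=> fM0 fM ff; apply/cvgrPdist_le => e e0.
have M1 : 0 < `|M| + 1 by apply: ltr_wpDl.
(* Mass outside [X] below this value contributes at most [e / 2]; the [+ 1] keeps the divisor
   positive when [M] is zero. *)
have d0 : 0 < e / 2 / (`|M| + 1) by rewrite !divr_gt0.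
have [X [finX _] Xd] : exists2 X, fsets [set: T] X &
    (1 - (e / 2 / (`|M| + 1))%:E < \sum_(t \in X) (w t)%:E)%E.
  have : ((1 - (e / 2 / (`|M| + 1)))%:E <
      ereal_sup [set (\sum_(t \in X) (w t)%:E)%E | X in fsets [set: T]])%E.
    by rewrite [ltRHS]w_sum1 lte_fin ltrBlDr ltrDl.
  by move=> /ereal_sup_gt[_ [X fX <-] Xd]; exists X.
have tail g : (forall t, 0 <= g t <= M) ->
    \sum_(t \in X) w t * g t <= wmean g <= \sum_(t \in X) w t * g t + e / 2.
  move=> gM; have bg : nonneg_bounded g by exists M.
  have bX : nonneg_bounded (fun t => (t \in X)%:R : R).
    by exists 1 => t; case: (t \in X); rewrite /= ?ler01 ?lexx.
  have bgX : nonneg_bounded (fun t => g t * (t \in X)%:R).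
    exists M => t; have /andP[g0 gMt] := gM t.
    by case: (t \in X); rewrite ?mulr1 ?mulr0 ?g0//= lexx (le_trans g0).
  have b1X : nonneg_bounded (fun t => 1 - (t \in X)%:R : R).
    by exists 1 => t; case: (t \in X); rewrite /= ?subrr ?subr0 ?ler01 ?lexx.
  rewrite -wmean_fset//; apply/andP; split.
    apply: le_wmean => // t _; have /andP[g0 _] := gM t.
    by case: (t \in X); rewrite ?mulr1 ?mulr0.
  apply: (@le_trans _ _ (wmean (fun t => g t * (t \in X)%:R +
      (`|M| + 1) * (1 - (t \in X)%:R)))).
    apply: le_wmean => //.
      by apply: nonneg_boundedD => //; apply: nonneg_boundedZ => //; exact: ltW.
    move=> t _; have /andP[g0 gMt] := gM t.
    case: (t \in X); rewrite ?mulr1 ?mulr0 ?subrr ?subr0 ?mulr1 ?mulr0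
      ?addr0 ?add0r//.
    by rewrite (le_trans gMt)// (le_trans (ler_norm _))// lerDl.
  rewrite wmeanD//; last by apply: nonneg_boundedZ => //; exact: ltW.
  rewrite lerD2l wmeanZ ?(ltW M1)//.
  rewrite mulrC -ler_pdivlMr//.
  have : wmean (fun t => 1 - (t \in X)%:R) + wmean (fun t => 1 * (t \in X)%:R) = 1.
    rewrite -wmeanD//; last first.
      by exists 1 => t; rewrite mul1r; case: (t \in X); rewrite /= ?ler01 ?lexx.
    by rewrite -[RHS]wmean_cst1; congr wmean; apply/funext => t; rewrite mul1r subrK.
  rewrite wmean_fset//; last by exists 1 => t; rewrite ler01/=.
  under eq_fsbigr do rewrite mulr1.
  move: Xd; rewrite fsumEFin// -EFinD lte_fin => Xd ?; lra.
have cvgX : (\sum_(t \in X) w t * f_ n t) @[n --> \oo] --> \sum_(t \in X) w t * f t.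
  rewrite fsbig_finite//=.
  under eq_fun do rewrite fsbig_finite//=.
  apply: cvg_big => [|t _]; first exact: add_continuous.
  apply: cvgM; [exact: cvg_cst|exact: ff].
have e20 : 0 < e / 2 by rewrite divr_gt0.
move/cvgrPdist_le: cvgX => /(_ _ e20); apply: filterS => n.
have /andP[a1 a2] := tail _ fM; have /andP[b1 b2] := tail _ (fM0 n).
rewrite !ler_norml => /andP[c1 c2].
apply/andP; split; lra.
Qed.

End WeightedMean.

(** * Inequalities for products of numbers in the unit interval *)

Section ProductInequalities.
Context {R : realType} {I : Type}.
Implicit Types (s : seq I) (a b c e : I -> R).

Lemma prod_cube s a : in_unit_cube a -> 0 <= \prod_(i <- s) a i <= 1.
Proof.
move=> a01; apply/andP; split; first by apply: prodr_ge0 => i _; case/andP: (a01 i).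
by apply: prodr_ile1 => i; rewrite a01.
Qed.

(** Products are not convex on the cube, but they are along increasing segments: for two factors the
    defect is [h * (1 - h) * (b i - a i) * (B - A)], with both increments nonnegative. *)
Lemma prod_convex s a b (h : R) : 0 <= h <= 1 ->
  (forall i, 0 <= a i <= b i) ->
  \prod_(i <- s) ((1 - h) * a i + h * b i) <=
    (1 - h) * \prod_(i <- s) a i + h * \prod_(i <- s) b i.
Proof.
move=> /andP[h0 h1] ab.
suff [] : \prod_(i <- s) ((1 - h) * a i + h * b i) <=
    (1 - h) * \prod_(i <- s) a i + h * \prod_(i <- s) b i /\
    0 <= \prod_(i <- s) a i <= \prod_(i <- s) b i by [].
elim: s => [|i s [IH /andP[A0 AB]]].
  by rewrite !big_nil !mulr1 subrK !lexx ler01.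
rewrite !big_cons; have /andP[a0 aleb] := ab i.
split; last by rewrite mulr_ge0//= ler_pM.
apply: (@le_trans _ _ (((1 - h) * a i + h * b i) *
  ((1 - h) * \prod_(i <- s) a i + h * \prod_(i <- s) b i))).
  by rewrite ler_wpM2l// addr_ge0// mulr_ge0// ?subr_ge0// (le_trans a0).
move: (\prod_(i <- s) a i) (\prod_(i <- s) b i) A0 AB => A B A0 AB.
rewrite -subr_ge0.
have -> : (1 - h) * (a i * A) + h * (b i * B) -
    ((1 - h) * a i + h * b i) * ((1 - h) * A + h * B) =
    h * (1 - h) * (b i - a i) * (B - A) by ring.
by rewrite !mulr_ge0// subr_ge0.
Qed.

(** With upper endpoint 1 the defect becomes [h * (1 - h) * (1 - a i) * (1 - A)], where [A] is the
    product of the other factors. It is below 1 because at least one other factor exists. *)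
Lemma prod_strictly_convex s a (h : R) : 0 < h < 1 ->
  (forall i, 0 <= a i < 1) -> (1 < size s)%N ->
  \prod_(i <- s) ((1 - h) * a i + h) < (1 - h) * \prod_(i <- s) a i + h.
Proof.
move=> /andP[h0 h1] a01; case: s => [|i [|j s]]// _.
rewrite big_cons [ltRHS](_ : _ = (1 - h) * (a i * \prod_(i <- j :: s) a i) + h);
  last by rewrite [in LHS]big_cons.
have a01' k : 0 <= a k <= 1 by case/andP: (a01 k) => -> /ltW ->.
have h01 : 0 <= h <= 1 by rewrite !ltW.
have := @prod_convex (j :: s) a (fun=> 1) h h01 a01'.
rewrite big1_eq mulr1.
have A1 : \prod_(i <- j :: s) a i < 1.
  rewrite big_cons; have /andP[aj0 aj1] := a01 j.
  apply: le_lt_trans aj1; rewrite ler_piMr//.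
  by case/andP: (prod_cube s a01').
move: (\prod_(i <- j :: s) a i) A1 => A A1.
have /andP[ai0 ai1] := a01 i.
move=> hA; apply: (@le_lt_trans _ _ (((1 - h) * a i + h) * ((1 - h) * A + h))).
  by rewrite ler_wpM2l// addr_ge0// ?(ltW h0)// mulr_ge0// subr_ge0 ltW.
rewrite -subr_gt0.
have -> : (1 - h) * (a i * A) + h - ((1 - h) * a i + h) * ((1 - h) * A + h) =
  h * (1 - h) * (1 - a i) * (1 - A) by ring.
by rewrite !mulr_gt0// subr_gt0.
Qed.

(** Supermodularity of the product. The increment [b * B - a * A] splits into
    [b * (B - A) + (b - a) * A], whose factors are all dominated by those of [c] and [e]. *)
Lemma prod_increment s a b c e :
  (forall i, [/\ 0 <= a i <= b i, a i <= c i <= e i & b i - a i <= e i - c i]) ->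
  \prod_(i <- s) b i - \prod_(i <- s) a i <=
  \prod_(i <- s) e i - \prod_(i <- s) c i.
Proof.
move=> H.
suff [] : [/\ 0 <= \prod_(i <- s) a i <= \prod_(i <- s) b i,
    \prod_(i <- s) a i <= \prod_(i <- s) c i <= \prod_(i <- s) e i &
    \prod_(i <- s) b i - \prod_(i <- s) a i <=
    \prod_(i <- s) e i - \prod_(i <- s) c i] by [].
elim: s => [|i s [/andP[A0 AB] /andP[AC CE] d]].
  by rewrite !big_nil !subrr !lexx ler01.
rewrite !big_cons; have [/andP[a0 ab] /andP[ac ce] de] := H i.
move: A0 AB AC CE d.
move: (\prod_(_ <- _) a _) (\prod_(_ <- _) b _) (\prod_(_ <- _) c _)
  (\prod_(_ <- _) e _) => A B C E A0 AB AC CE d.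
have c0 : 0 <= c i by lra.
split; [by rewrite mulr_ge0//= ler_pM|by rewrite !ler_pM// (le_trans A0)|].
have -> : b i * B - a i * A = b i * (B - A) + (b i - a i) * A by ring.
have -> : e i * E - c i * C = e i * (E - C) + (e i - c i) * C by ring.
by apply: lerD; apply: ler_pM => //; lra.
Qed.

(** A union bound for failure probabilities. If [x + y - 1] and [A + B - 1] are positive, then
    [x * A + y * B - 1] is at most their product; otherwise it is at most 0. *)
Lemma prod_union_bound s a b c : in_unit_cube a -> in_unit_cube b ->
  in_unit_cube c -> (forall i, a i + b i <= c i + 1) ->
  \prod_(i <- s) a i + \prod_(i <- s) b i <= \prod_(i <- s) c i + 1.
Proof.
move=> a01 b01 c01 abc.
elim: s => [|i s IH]; first by rewrite !big_nil.
have := prod_cube s a01; have := prod_cube s b01; have := prod_cube s c01.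
rewrite !big_cons; move: IH.
move: (\prod_(_ <- _) a _) (\prod_(_ <- _) b _) (\prod_(_ <- _) c _) => A B C.
move: (a01 i) (b01 i) (c01 i) (abc i); move: (a i) (b i) (c i) => x y z.
move=> /andP[x0 x1] /andP[y0 y1] /andP[z0 z1] xyz ABC /andP[C0 C1] /andP[B0 B1]
  /andP[A0 A1].
have [zle|zle] := leP (x + y - 1) 0.
  have [Cle|Cle] := leP (A + B - 1) 0; nra.
have [Cle|Cle] := leP (A + B - 1) 0; first nra.
have : (x + y - 1) * (A + B - 1) <= z * C by apply: ler_pM; lra.
nra.
Qed.

End ProductInequalities.

(** * Monotonicity, convexity and continuity of the generating functions *)

Section OffspringGeneratingFunction.
Context {R : realType} {d : nat}.
Implicit Types (r : offspring d) (s t : typ d -> R).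

(** Listing individuals one by one turns a monomial with exponents into a plain product, the form
    treated by the product inequalities. *)
Definition population_seq r : seq (typ d) :=
  flatten [seq nseq (r l) l | l <- finsupp r].

Lemma prod_population s r :
  \prod_(l <- finsupp r) s l ^+ r l = \prod_(l <- population_seq r) s l.
Proof.
rewrite big_flatten big_map; apply: eq_bigr => l _.
by rewrite big_nseq -Monoid.iteropE.
Qed.

Lemma size_population r : size (population_seq r) = (\sum_(l <- finsupp r) r l)%N.
Proof.
rewrite size_flatten /shape -map_comp sumnE big_map.
by apply: eq_bigr => l _ /=; rewrite size_nseq.
Qed.

Lemma mem_population r l : (l \in population_seq r) = (0 < r l)%N.
Proof.
apply/flatten_mapP/idP => [[k _ /[!mem_nseq] /andP[rk /eqP->]]//|rl].
exists l; last by rewrite mem_nseq eqxx rl.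
by rewrite mem_finsupp -lt0n.
Qed.

Context (p : typ d -> offspring d -> R) (hp : lower_hessenberg_law p).
Local Notation G := (pgf p).

Let p_ge0 := law_ge0 hp.
Let p_sum1 := law_sum1 hp.

Let pgfE j s : G j s = wmean (p j) (fun r => \prod_(l <- population_seq r) s l).
Proof.
by rewrite /pgf /wmean; congr fine; apply: eq_esum => r _; rewrite prod_population.
Qed.

Let prod_bounded s : in_unit_cube s ->
  nonneg_bounded (fun r => \prod_(l <- population_seq r) s l).
Proof. by move=> s01; exists 1 => r; exact: prod_cube. Qed.

Lemma pgf_esum j s : in_unit_cube s ->
  (\esum_(r in [set: offspring d])
    (p j r * \prod_(l <- population_seq r) s l)%:E = (pgf p j s)%:E)%E.
Proof.
move=> s01; rewrite pgfE fineK//.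
exact: (wmean_fin (p_ge0 j) (p_sum1 j) (prod_bounded s01)).
Qed.

Lemma pgf_cube s : in_unit_cube s -> in_unit_cube (fun j => G j s).
Proof. by move=> s01 j; have [-> /andP[_ ->]] := pgf_le hp j s01 s01 (fun=> lexx _). Qed.

Lemma pgf1 j : G j (fun=> 1) = 1.
Proof.
rewrite pgfE -[RHS](wmean_cst1 (p_sum1 j)); congr wmean.
by apply/funext => r; rewrite big1_eq.
Qed.

Lemma pgf_cvg (s_ : nat -> typ d -> R) s : (forall n, in_unit_cube (s_ n)) ->
  in_unit_cube s -> (forall i, s_ n i @[n --> \oo] --> s i) ->
  forall j, G j (s_ n) @[n --> \oo] --> G j s.
Proof.
move=> s01_ s01 cs j; under eq_cvg do rewrite pgfE.
rewrite pgfE; apply: (@cvg_wmean _ _ _ (p_ge0 j) (p_sum1 j) _ _ 1).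
- by move=> n r; exact: prod_cube.
- by move=> r; exact: prod_cube.
- move=> r; apply: cvg_big => [|l _]; [exact: mul_continuous|exact: cs].
Qed.

(* The four-term shape covers convexity, comparison of increments and union
   bounds at once. *)
Lemma pgf_comb_le j (x y z v : R) (a b c e : typ d -> R) :
  0 <= x -> 0 <= y -> 0 <= z -> 0 <= v ->
  in_unit_cube a -> in_unit_cube b -> in_unit_cube c -> in_unit_cube e ->
  (forall r, p j r != 0 ->
    x * \prod_(l <- population_seq r) a l +
      y * \prod_(l <- population_seq r) b l <=
    z * \prod_(l <- population_seq r) c l +
      v * \prod_(l <- population_seq r) e l) ->
  x * G j a + y * G j b <= z * G j c + v * G j e.
Proof.
move=> x0 y0 z0 v0 a01 b01 c01 e01 H; rewrite !pgfE.
have B (k : R) (u : typ d -> R) : 0 <= k -> in_unit_cube u -> nonneg_bounded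
    (fun r => k * \prod_(l <- population_seq r) u l).
  by move=> k0 u01; have := prod_bounded u01; exact: nonneg_boundedZ.
have pa := prod_bounded a01; have pb := prod_bounded b01.
have pc := prod_bounded c01; have pe := prod_bounded e01.
have qa := B _ _ x0 a01; have qb := B _ _ y0 b01.
have qc := B _ _ z0 c01; have qe := B _ _ v0 e01.
have ge0 := p_ge0 j; have sum1 := p_sum1 j.
rewrite -!wmeanZ// -?wmeanD//.
by apply: le_wmean => //; apply: nonneg_boundedD.
Qed.

Lemma pgf_comb_lt j (x y z v : R) (a b c e : typ d -> R) r0 :
  0 <= x -> 0 <= y -> 0 <= z -> 0 <= v ->
  in_unit_cube a -> in_unit_cube b -> in_unit_cube c -> in_unit_cube e ->
  (forall r, p j r != 0 ->
    x * \prod_(l <- population_seq r) a l +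
      y * \prod_(l <- population_seq r) b l <=
    z * \prod_(l <- population_seq r) c l +
      v * \prod_(l <- population_seq r) e l) ->
  p j r0 != 0 ->
  x * \prod_(l <- population_seq r0) a l +
    y * \prod_(l <- population_seq r0) b l <
  z * \prod_(l <- population_seq r0) c l +
    v * \prod_(l <- population_seq r0) e l ->
  x * G j a + y * G j b < z * G j c + v * G j e.
Proof.
move=> x0 y0 z0 v0 a01 b01 c01 e01 H pr0 H0; rewrite !pgfE.
have B (k : R) (u : typ d -> R) : 0 <= k -> in_unit_cube u -> nonneg_bounded
    (fun r => k * \prod_(l <- population_seq r) u l).
  by move=> k0 u01; have := prod_bounded u01; exact: nonneg_boundedZ.
have pa := prod_bounded a01; have pb := prod_bounded b01.
have pc := prod_bounded c01; have pe := prod_bounded e01.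
have qa := B _ _ x0 a01; have qb := B _ _ y0 b01.
have qc := B _ _ z0 c01; have qe := B _ _ v0 e01.
have ge0 := p_ge0 j; have sum1 := p_sum1 j.
rewrite -!wmeanZ// -?wmeanD//.
by apply: (lt_wmean ge0 sum1 (t0 := r0)) => //; apply: nonneg_boundedD.
Qed.

Lemma cube0 : in_unit_cube ((fun=> 0) : typ d -> R).
Proof. by move=> i; rewrite lexx ler01. Qed.

Lemma cube1 : in_unit_cube ((fun=> 1) : typ d -> R).
Proof. by move=> i; rewrite lexx ler01. Qed.

(** Almost surely the children of [j] lie at level at most [j.1.+1], so the other coordinates never
    enter the product. *)
Lemma pgf_le_local j s t : in_unit_cube s -> in_unit_cube t ->
  (forall l, (l.1 <= j.1.+1)%N -> s l <= t l) -> G j s <= G j t.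
Proof.
move=> s01 t01 st.
have := @pgf_comb_le j 1 0 1 0 s s t t ler01 (lexx _) ler01 (lexx _) s01 s01 t01 t01.
rewrite !mul1r !mul0r !addr0; apply=> r pr; rewrite !mul1r !mul0r !addr0.
rewrite !big_seq; apply: ler_prod => l; rewrite mem_population => rl.
have /andP[-> _] := s01 l; rewrite /= st// leqNgt; apply/negP => lj.
by rewrite (law_hessenberg hp pr lj) in rl.
Qed.

Lemma pgf_mono j s t : in_unit_cube s -> in_unit_cube t ->
  (forall l, s l <= t l) -> G j s <= G j t.
Proof. by move=> s01 t01 st; apply: pgf_le_local. Qed.

Lemma cube_convex s t (h : R) : 0 <= h <= 1 -> in_unit_cube s -> in_unit_cube t ->
  in_unit_cube (fun i => (1 - h) * s i + h * t i).
Proof.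
move=> /andP[h0 h1] s01 t01 i; have /andP[? ?] := s01 i; have /andP[? ?] := t01 i.
by apply/andP; split; nra.
Qed.

Lemma pgf_convex j s t (h : R) : 0 <= h <= 1 ->
  in_unit_cube s -> in_unit_cube t -> (forall i, s i <= t i) ->
  G j (fun i => (1 - h) * s i + h * t i) <= (1 - h) * G j s + h * G j t.
Proof.
move=> h01 s01 t01 st; have c01 := cube_convex h01 s01 t01.
have /andP[h0 h1] := h01.
have := @pgf_comb_le j 1 0 (1 - h) h _ _ s t ler01 (lexx _) _ h0 c01 c01 s01 t01.
rewrite !mul1r !mul0r !addr0; apply => [|r _]; first by rewrite subr_ge0.
rewrite mul1r mul0r addr0; apply: prod_convex => // i.
by rewrite st; case/andP: (s01 i) => ->.
Qed.

Lemma pgf_strictly_convex j s (h : R) r : 0 < h < 1 ->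
  (forall i, 0 <= s i < 1) -> p j r != 0 -> (1 < \sum_(l <- finsupp r) r l)%N ->
  G j (fun i => (1 - h) * s i + h) < (1 - h) * G j s + h.
Proof.
move=> h01 s1 pr rs; have /andP[h0 h1] := h01.
have s01 : in_unit_cube s by move=> i; case/andP: (s1 i) => -> /ltW ->.
have h01' : 0 <= h <= 1 by rewrite !ltW.
have c01 : in_unit_cube (fun i => (1 - h) * s i + h).
  by move=> i; have := cube_convex h01' s01 cube1 i; rewrite mulr1.
have h0' := ltW h0.
have h1' : 0 <= 1 - h by rewrite subr_ge0 ltW.
have := @pgf_comb_lt j 1 0 (1 - h) h _ _ s (fun=> 1) r ler01 (lexx _) h1' h0'
  c01 c01 s01 cube1.
rewrite pgf1 mulr1 !mul1r !mul0r !addr0; apply=> // [r' _|].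
  have s1' i : 0 <= s i <= 1 by exact: s01.
  have := @prod_convex _ _ (population_seq r') s (fun=> 1) h h01' s1'.
  by under eq_bigr do rewrite mulr1; rewrite mul1r mul0r addr0.
rewrite big1_eq mulr1.
by apply: prod_strictly_convex => //; rewrite size_population.
Qed.

Lemma pgf_increment j (a b c e : typ d -> R) :
  in_unit_cube a -> in_unit_cube b -> in_unit_cube c -> in_unit_cube e ->
  (forall i, [/\ a i <= b i, a i <= c i <= e i & b i - a i <= e i - c i]) ->
  G j b - G j a <= G j e - G j c.
Proof.
move=> a01 b01 c01 e01 H.
(* The difference inequality is rearranged as [b + c <= e + a], since only nonnegative coefficients
   are allowed. *)
have := @pgf_comb_le j 1 1 1 1 b c e a ler01 ler01 ler01 ler01 b01 c01 e01 a01.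
rewrite !mul1r => H1; rewrite -subr_ge0; suff : G j b + G j c <= G j e + G j a by lra.
apply: H1 => r _.
rewrite !mul1r.
have := @prod_increment _ _ (population_seq r) a b c e.
move=> H2; suff : \prod_(l <- population_seq r) b l -
    \prod_(l <- population_seq r) a l <=
    \prod_(l <- population_seq r) e l - \prod_(l <- population_seq r) c l by lra.
apply: H2 => i.
by have [? ? ?] := H i; split=> //; apply/andP; split=> //; case/andP: (a01 i).
Qed.

Lemma pgf_union_bound j (a b c : typ d -> R) :
  in_unit_cube a -> in_unit_cube b -> in_unit_cube c ->
  (forall i, a i + b i <= c i + 1) -> G j a + G j b <= G j c + 1.
Proof.
move=> a01 b01 c01 abc.
have := @pgf_comb_le j 1 1 1 1 a b c (fun=> 1) ler01 ler01 ler01 ler01 a01 b01 c01 cube1.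
rewrite pgf1 !mul1r; apply=> r _; rewrite !mul1r big1_eq.
exact: prod_union_bound.
Qed.

(** With at most one child, [pgf p j] is affine: a childless outcome contributes 0 to both sides,
    and a single child contributes the hypothesis at its type. *)
Lemma pgf_unary j (a b e : typ d -> R) (h : R) : 0 <= h ->
  (forall r, p j r != 0 -> (\sum_(l <- finsupp r) r l <= 1)%N) ->
  in_unit_cube a -> in_unit_cube b -> in_unit_cube e ->
  (forall i, h * (1 - a i) <= b i - e i) ->
  h * (1 - G j a) <= G j b - G j e.
Proof.
move=> h0 r1 a01 b01 e01 H.
have := @pgf_comb_le j h 1 h 1 (fun=> 1) e a b h0 ler01 h0 ler01 cube1 e01 a01 b01.
rewrite pgf1 !mul1r => H1; suff : h * 1 + G j e <= h * G j a + G j b by lra.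
apply: H1 => r pr.
rewrite big1_eq !mul1r mulr1; have := r1 _ pr; rewrite -size_population.
case: (population_seq r) => [|i [|]]// _; first by rewrite !big_nil; lra.
by rewrite !big_seq1; have := H i; lra.
Qed.

Lemma mean_offspring_gt0 i j : (0 < mean_offspring p i j)%E ->
  exists2 r, p i r != 0 & (0 < r j)%N.
Proof.
move=> M0; apply: contrapT => H; move: M0.
rewrite /mean_offspring esum1 ?ltxx// => r _.
have [->|pr] := eqVneq (p i r) 0; first by rewrite mul0r.
have [rj|rj] := posnP (r j); first by rewrite rj mulr0.
by exfalso; apply: H; exists r.
Qed.

(** Some offspring vector of positive probability contains [j]. Positivity of [t] prevents the
    remaining factors from cancelling the strict gap at [j]. *)
Lemma pgf_lt i j s t : in_unit_cube s -> in_unit_cube t ->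
  (forall l, s l <= t l) -> (forall l, 0 < t l) ->
  (0 < mean_offspring p i j)%E -> s j < t j -> G i s < G i t.
Proof.
move=> s01 t01 st t0 /mean_offspring_gt0[r pr rj] stj.
have := @pgf_comb_lt i 1 0 1 0 s s t t r ler01 (lexx _) ler01 (lexx _) s01 s01 t01 t01.
rewrite !mul1r !mul0r !addr0; apply => // [r' _|]; rewrite ?mul1r ?mul0r ?addr0.
  by apply: ler_prod => l _; rewrite st; case/andP: (s01 l) => ->.
rewrite -mem_population in rj.
rewrite (big_rem j rj)/= [ltRHS](big_rem j rj)/=.
apply: (@le_lt_trans _ _ (s j * \prod_(l <- rem j (population_seq r)) t l)).
  rewrite ler_wpM2l//; first by case/andP: (s01 j).
  by apply: ler_prod => l _; rewrite st; case/andP: (s01 l) => ->.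
by rewrite ltr_pM2r//; apply: prodr_gt0.
Qed.

End OffspringGeneratingFunction.

(** * Monotone iteration on the unit cube *)

Section CubeOperators.
Context {R : realType} {I : Type}.
Implicit Types (s t : I -> R) (F : (I -> R) -> I -> R).

Definition pointwise_lim (f : nat -> I -> R) : I -> R :=
  fun i => limn (fun n => f n i).

Lemma nondecreasing_cube_lim (f : nat -> I -> R) :
  (forall n, in_unit_cube (f n)) -> (forall n i, f n i <= f n.+1 i) ->
  [/\ in_unit_cube (pointwise_lim f),
      (forall i, f n i @[n --> \oo] --> pointwise_lim f i) &
      forall n i, f n i <= pointwise_lim f i].
Proof.
move=> f01 fS.
have nd i : nondecreasing_seq (fun n => f n i) by apply/nondecreasing_seqP.
have cf i : cvgn (fun n => f n i).
  apply: nondecreasing_is_cvgn => //; exists 1 => _ [n _ <-].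
  by case/andP: (f01 n i).
split=> [i|i|n i]; last exact: nondecreasing_cvgn_le.
  apply/andP; split; [apply: limr_ge|apply: limr_le] => //;
  by apply: nearW => n; case/andP: (f01 n i).
exact: cf.
Qed.

Lemma nonincreasing_cube_lim (f : nat -> I -> R) :
  (forall n, in_unit_cube (f n)) -> (forall n i, f n.+1 i <= f n i) ->
  [/\ in_unit_cube (pointwise_lim f),
      (forall i, f n i @[n --> \oo] --> pointwise_lim f i) &
      forall n i, pointwise_lim f i <= f n i].
Proof.
move=> f01 fS.
have nd i : nonincreasing_seq (fun n => f n i) by apply/nonincreasing_seqP.
have cf i : cvgn (fun n => f n i).
  apply: nonincreasing_is_cvgn => //; exists 0 => _ [n _ <-].
  by case/andP: (f01 n i).
split=> [i|i|n i]; last exact: nonincreasing_cvgn_ge.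
  apply/andP; split; [apply: limr_ge|apply: limr_le] => //;
  by apply: nearW => n; case/andP: (f01 n i).
exact: cf.
Qed.

Record cube_operator F : Prop := CubeOperator {
  cube_op_cube : forall s, in_unit_cube s -> in_unit_cube (F s) ;
  cube_op_mono : forall s t, in_unit_cube s -> in_unit_cube t ->
    (forall i, s i <= t i) -> forall i, F s i <= F t i ;
  cube_op_cvg : forall (s_ : nat -> I -> R) s, (forall n, in_unit_cube (s_ n)) ->
    in_unit_cube s -> (forall i, s_ n i @[n --> \oo] --> s i) ->
    forall i, F (s_ n) i @[n --> \oo] --> F s i
}.

Definition iter_lim F s := pointwise_lim (fun n => iter n F s).
Definition least_fixpoint F := iter_lim F (fun=> 0).
Definition greatest_fixpoint F := iter_lim F (fun=> 1).

Section Iteration.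
Context (F : (I -> R) -> I -> R) (hF : cube_operator F).

Lemma iter_cube s n : in_unit_cube s -> in_unit_cube (iter n F s).
Proof. by move=> s01; elim: n => //= n; exact: cube_op_cube. Qed.

Lemma iter_mono s t n : in_unit_cube s -> in_unit_cube t ->
  (forall i, s i <= t i) -> forall i, iter n F s i <= iter n F t i.
Proof.
move=> s01 t01 st; elim: n => //= n IH.
by apply: cube_op_mono => //; exact: iter_cube.
Qed.

Let lim_fixpoint s t : in_unit_cube s -> in_unit_cube t ->
  (forall i, iter n F s i @[n --> \oo] --> t i) -> forall i, F t i = t i.
Proof.
move=> s01 t01 st i.
have c1 : F (iter n F s) i @[n --> \oo] --> F t i.
  by apply: (cube_op_cvg hF) => // n; exact: iter_cube.
have c2 : iter n.+1 F s i @[n --> \oo] --> t i.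
  by have := st i; rewrite -[X in X -> _](cvg_shiftS (fun n => iter n F s i)).
by apply: (cvg_unique _ c1 c2).
Qed.

Lemma iter_lim_up s : in_unit_cube s -> (forall i, s i <= F s i) ->
  [/\ in_unit_cube (iter_lim F s),
      (forall i, iter n F s i @[n --> \oo] --> iter_lim F s i),
      (forall n i, iter n F s i <= iter_lim F s i) &
      forall i, F (iter_lim F s) i = iter_lim F s i].
Proof.
move=> s01 sF.
have H n i : iter n F s i <= iter n.+1 F s i.
  rewrite iterSr; apply: iter_mono => //; exact: cube_op_cube.
have [c1 c2 c3] := nondecreasing_cube_lim (fun n => iter_cube n s01) H.
by split => //; apply: lim_fixpoint c2.
Qed.

Lemma iter_lim_down s : in_unit_cube s -> (forall i, F s i <= s i) ->
  [/\ in_unit_cube (iter_lim F s),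
      (forall i, iter n F s i @[n --> \oo] --> iter_lim F s i),
      (forall n i, iter_lim F s i <= iter n F s i) &
      forall i, F (iter_lim F s) i = iter_lim F s i].
Proof.
move=> s01 sF.
have H n i : iter n.+1 F s i <= iter n F s i.
  rewrite iterSr; apply: iter_mono => //; exact: cube_op_cube.
have [c1 c2 c3] := nonincreasing_cube_lim (fun n => iter_cube n s01) H.
by split => //; apply: lim_fixpoint c2.
Qed.

Let zero01 : in_unit_cube ((fun=> 0) : I -> R).
Proof. by move=> i; rewrite lexx ler01. Qed.

Let one01 : in_unit_cube ((fun=> 1) : I -> R).
Proof. by move=> i; rewrite lexx ler01. Qed.

Lemma least_fixpointP :
  [/\ in_unit_cube (least_fixpoint F),
      (forall i, iter n F (fun=> 0) i @[n --> \oo] --> least_fixpoint F i),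
      (forall n i, iter n F (fun=> 0) i <= least_fixpoint F i) &
      forall i, F (least_fixpoint F) i = least_fixpoint F i].
Proof.
by apply: iter_lim_up => // i; case/andP: (cube_op_cube hF zero01 i).
Qed.

Lemma greatest_fixpointP :
  [/\ in_unit_cube (greatest_fixpoint F),
      (forall i, iter n F (fun=> 1) i @[n --> \oo] --> greatest_fixpoint F i),
      (forall n i, greatest_fixpoint F i <= iter n F (fun=> 1) i) &
      forall i, F (greatest_fixpoint F) i = greatest_fixpoint F i].
Proof.
by apply: iter_lim_down => // i; case/andP: (cube_op_cube hF one01 i).
Qed.

Lemma least_fixpoint_le t : in_unit_cube t -> (forall i, F t i <= t i) ->
  forall i, least_fixpoint F i <= t i.
Proof.
move=> t01 tF i; have [_ c _ _] := least_fixpointP.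
apply: (cvgr_to_le (c i)); apply: nearW => n.
elim: n i => [|n IH] i; first by case/andP: (t01 i).
apply: le_trans (tF i); rewrite /=; apply: (cube_op_mono hF) => //; exact: iter_cube.
Qed.

Lemma greatest_fixpoint_ge t : in_unit_cube t -> (forall i, t i <= F t i) ->
  forall i, t i <= greatest_fixpoint F i.
Proof.
move=> t01 tF i; have [_ c _ _] := greatest_fixpointP.
apply: (cvgr_to_ge (c i)); apply: nearW => n.
elim: n i => [|n IH] i; first by case/andP: (t01 i).
apply: (le_trans (tF i)) => /=; apply: (cube_op_mono hF) => //; exact: iter_cube.
Qed.

Lemma least_fixpoint_minimal : minimal_solution (fun i s => F s i) (least_fixpoint F).
Proof.
have [c1 _ _ c2] := least_fixpointP; split => // t t01 tF.
by apply: least_fixpoint_le => // i; rewrite -tF.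
Qed.

End Iteration.
End CubeOperators.

Lemma minimal_solution_unique {R : realType} {I : Type} (F : I -> (I -> R) -> R) s t :
  minimal_solution F s -> minimal_solution F t -> s = t.
Proof.
move=> [s01 sF sm] [t01 tF tm]; apply/funext => i; apply/eqP.
by rewrite eq_le sm ?tm.
Qed.

(** * Processes with frozen types, and the avoidance probabilities *)

Section BoundaryOperators.
Context {R : realType} {d : nat} (p : typ d -> offspring d -> R)
  (hp : lower_hessenberg_law p).
Implicit Types (A B : set (typ d)) (c s t : typ d -> R).
Local Notation G := (fun s i => pgf p i s).

(* Types in [B] are frozen; [c] is the probability assigned to a frozen one. *)
Definition boundary_op B c s : typ d -> R :=
  fun i => if `[< B i >] then c i else pgf p i s.

Lemma boundary_op_in B c s i : B i -> boundary_op B c s i = c i.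
Proof. by move=> Bi; rewrite /boundary_op asboolT. Qed.

Lemma boundary_op_out B c s i : ~ B i -> boundary_op B c s i = pgf p i s.
Proof. by move=> Bi; rewrite /boundary_op asboolF. Qed.

Lemma boundary_op_le B c c' s t i : in_unit_cube s -> in_unit_cube t ->
  (forall i, B i -> c i <= c' i) -> (forall i, s i <= t i) ->
  boundary_op B c s i <= boundary_op B c' t i.
Proof.
move=> s01 t01 cc' st; rewrite /boundary_op; case: asboolP => [/cc'//|_].
exact: pgf_mono.
Qed.

Lemma pgf_operator : cube_operator G.
Proof.
split=> [s|s t s01 t01 st i|s_ s]; [exact: pgf_cube|exact: pgf_mono|exact: pgf_cvg].
Qed.

Lemma boundary_operator B c : in_unit_cube c -> cube_operator (boundary_op B c).
Proof.
move=> c01; split=> [s s01 i|s t s01 t01 st i|s_ s s01_ s01 cs i].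
- by rewrite /boundary_op; case: ifP => _; [exact: c01|exact: pgf_cube].
- exact: boundary_op_le.
- rewrite /boundary_op; case: ifP => _; [exact: cvg_cst|exact: pgf_cvg].
Qed.

Lemma boundary_op_convex B c c' e s t (h : R) i : 0 <= h <= 1 ->
  in_unit_cube s -> in_unit_cube t -> (forall i, s i <= t i) ->
  (B i -> e i <= (1 - h) * c i + h * c' i) ->
  boundary_op B e (fun i => (1 - h) * s i + h * t i) i <=
    (1 - h) * boundary_op B c s i + h * boundary_op B c' t i.
Proof.
move=> h01 s01 t01 st ec; rewrite /boundary_op; case: asboolP => [/ec//|_].
exact: pgf_convex.
Qed.

Definition modified_boundary A (k l : int) : set (typ d) :=
  (A `&` ~` upto_level d k) `|` (~` A `&` ~` upto_level d l).

Definition boundary_value A : typ d -> R := fun i => if `[< A i >] then 0 else 1.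

Lemma boundary_value_cube A : in_unit_cube (boundary_value A).
Proof. by move=> i; rewrite /boundary_value; case: ifP; rewrite !lexx ?ler01. Qed.

(** Minimal solutions are unique, so the one picked by [xget] is the increasing limit of the
    iterates from 0 and becomes accessible to induction. *)
Lemma modified_extinctionE A k l : modified_extinction p A k l =
  least_fixpoint (boundary_op (modified_boundary A k l) (boundary_value A)).
Proof.
apply: (minimal_solution_unique (modified_extinctionP hp A k l)).
have := least_fixpoint_minimal (boundary_operator (modified_boundary A k l)
  (boundary_value_cube A)).
congr minimal_solution; apply/funext => i; apply/funext => s.
rewrite /boundary_op /modified_pgf /boundary_value.
case: (asboolP ((A `&` ~` upto_level d k) i)) => [[Ai ki]|nk].
  by rewrite asboolT ?asboolT//; left.
case: (asboolP ((~` A `&` ~` upto_level d l) i)) => [[Ai li]|nl].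
  by rewrite asboolT ?asboolF//; right.
by rewrite asboolF// => -[].
Qed.

(* [i]-th entry: the probability of never having an individual in [A]. *)
Definition avoidance A : typ d -> R := greatest_fixpoint (boundary_op A (fun=> 0)).

(* [i]-th entry: the probability of having no individual in [A] after some
   generation. *)
Definition eventual_avoidance A : typ d -> R := iter_lim G (avoidance A).

Lemma avoidanceP A : [/\ in_unit_cube (avoidance A),
   (forall i, A i -> avoidance A i = 0) &
   (forall i, ~ A i -> avoidance A i = pgf p i (avoidance A))].
Proof.
have [c1 _ _ c2] := greatest_fixpointP (boundary_operator A (@cube0 R d)).
split=> // i Ai; rewrite [LHS](esym (c2 i)); first by rewrite boundary_op_in.
by rewrite boundary_op_out.
Qed.

Lemma avoidance_le_pgf A i : avoidance A i <= pgf p i (avoidance A).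
Proof.
have [c1 c2 c3] := avoidanceP A; have [Ai|Ai] := pselect (A i).
  by rewrite c2//; case/andP: (pgf_cube hp c1 i).
by rewrite [leLHS]c3.
Qed.

Lemma eventual_avoidanceP A : [/\ in_unit_cube (eventual_avoidance A),
   (forall i, iter n G (avoidance A) i @[n --> \oo] --> eventual_avoidance A i),
   (forall n i, iter n G (avoidance A) i <= eventual_avoidance A i) &
   (forall i, pgf p i (eventual_avoidance A) = eventual_avoidance A i)].
Proof.
have [c1 _ _] := avoidanceP A.
have [? ? ? ?] := iter_lim_up pgf_operator c1 (avoidance_le_pgf A).
by split.
Qed.

Lemma avoidance_le_eventual A i : avoidance A i <= eventual_avoidance A i.
Proof. by have [_ _ h _] := eventual_avoidanceP A; exact: (h 0%N). Qed.

End BoundaryOperators.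

(** * Lower and upper bounds for the truncated processes *)

Section UpperAndLowerBounds.
Context {R : realType} {d : nat} (p : typ d -> offspring d -> R)
  (hp : lower_hessenberg_law p).
Implicit Types (A B C D : set (typ d)) (c s t : typ d -> R).
Local Notation G := (fun s i => pgf p i s).
Local Notation level_le l := (upto_level d (Posz l)).
Local Notation bop := (boundary_op p).

(** The form in which irreducibility is used: a property inherited by parent types from child types
    propagates backward along paths leading to [j]. *)
Lemma irreducible_ind (Q : typ d -> Prop) j : irreducible_law p -> Q j ->
  (forall x y, (0 < mean_offspring p x y)%E -> Q y -> Q x) -> forall i, Q i.
Proof.
move=> hirr Qj H i; have [s [+ sj]] := hirr i j.
elim: s i sj => [|x s IH] i /=; first by move=> ->.
by move=> sj /andP[ix xs]; apply: (H i x) => //; exact: IH.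
Qed.

(** If a child type has value below 1, then its parent [x] satisfies
    [s x <= pgf p x s < pgf p x 1 = 1]. *)
Lemma lt1_of_le_pgf s b : irreducible_law p -> in_unit_cube s ->
  (forall i, s i <= pgf p i s) -> s b < 1 -> forall i, s i < 1.
Proof.
move=> hirr s01 sG sb; apply: (irreducible_ind hirr sb) => x y xy sy.
apply: (le_lt_trans (sG x)); rewrite -[ltRHS](pgf1 hp x).
apply: (pgf_lt hp s01 (@cube1 R d) _ _ xy sy) => // l.
by case/andP: (s01 l).
Qed.

Lemma uniform_lt1 C s : finite_set C -> in_unit_cube s ->
  (forall i, C i -> s i < 1) ->
  exists2 h : R, 0 <= h < 1 & forall i, C i -> s i <= h.
Proof.
move=> /finite_seqP[l ->] s01; elim: l => [_|x l IH H].
  by exists 0; rewrite ?lexx ?ltr01// => i.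
have [i il|h /andP[h0 h1] hl] := IH; first by apply: H; rewrite /= in_cons il orbT.
exists (Num.max (s x) h) => [|i /=].
  by rewrite le_max h0 orbT/= gt_max h1 H//= mem_head.
rewrite in_cons => /orP[/eqP->|il]; first by rewrite le_max lexx.
by rewrite le_max hl ?orbT.
Qed.

Lemma finite_level_le (l : nat) : finite_set (level_le l).
Proof.
apply: (@sub_finite_set _ _ (`I_l.+1 `*` [set: 'I_d])).
  by move=> [x i] /=; rewrite /upto_level/= lez_nat ltnS.
by apply: finite_setX => //; exact: finite_finset.
Qed.

Lemma avoidance_le_modified A (k l : nat) : (forall i, avoidance p A i < 1) ->
  forall i, avoidance p A i <= modified_extinction p A k%:Z l%:Z i.
Proof.
set u := avoidance p A => u1.
have [u01 uA uG] := avoidanceP hp A; rewrite -/u in u01 uA uG.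
have [h /andP[h0 h1] hl] := uniform_lt1 (finite_level_le l) u01 (fun i _ => u1 i).
have h01 : 0 <= h <= 1 by rewrite h0 ltW.
(* The frozen types hold the conditional probability of still avoiding [A]. *)
pose B := A `|` ~` level_le l; pose K := bop B u.
have hK : cube_operator K := boundary_operator hp B u01.
have Ku i : K u i = u i.
  rewrite /K; have [Bi|Bi] := pselect (B i); first by rewrite boundary_op_in.
  by rewrite boundary_op_out// -uG// => Ai; apply: Bi; left.
have [b01 bc _ bK] := least_fixpointP hK.
have [x01 xc _ xK] := greatest_fixpointP hK.
(* The fixed point [x] of [K] satisfies the inequality characterizing [u]. Only frozen types outside
   [A] need care: there [x] equals [u = G u], and [u <= x] gives [G u <= G x]. *)
have xu i : greatest_fixpoint K i <= u i.
  have ux j : u j <= greatest_fixpoint K j.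
    by apply: greatest_fixpoint_ge => // j'; rewrite Ku.
  apply: (greatest_fixpoint_ge (boundary_operator hp A (@cube0 R d))) => // j.
  have [Aj|Aj] := pselect (A j).
    rewrite boundary_op_in// -(xK j) /K boundary_op_in ?uA//; by left.
  rewrite boundary_op_out// -[leLHS](xK j) /K.
  have [Bj|Bj] := pselect (B j); last by rewrite boundary_op_out.
  by rewrite boundary_op_in// [leLHS]uG//; exact: pgf_mono.
have K01 : in_unit_cube (K (fun=> 0)) := cube_op_cube hK (@cube0 R d).
have K1 i : K (fun=> 0) i <= 1 by case/andP: (K01 i).
(* The lower iterates start from [K 0], which already equals [u] on frozen types; the remaining
   types lie in [T_l], where [u <= h]. *)
have step n i : u i <= (1 - h) * iter n K (K (fun=> 0)) i + h * iter n K (fun=> 1) i.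
  elim: n i => [|n IH] i /=.
    rewrite mulr1; have [Bi|Bi] := pselect (B i).
      rewrite /K boundary_op_in//; have /andP[ui0 ui1] := u01 i.
      by rewrite -subr_ge0; nra.
    apply: (@le_trans _ _ h); last first.
      by rewrite lerDr mulr_ge0 ?subr_ge0 ?(ltW h1)//; case/andP: (K01 i).
    by apply: hl; apply: contrapT => li; apply: Bi; right.
  rewrite -[leLHS]Ku.
  have s01 := iter_cube hK n K01; have t01 := iter_cube hK n (@cube1 R d).
  apply: (@le_trans _ _ (K (fun i => (1 - h) * iter n K (K (fun=> 0)) i +
    h * iter n K (fun=> 1) i) i)).
    by apply: (cube_op_mono hK) => //; exact: cube_convex.
  apply: (boundary_op_convex hp) => // [j|_]; last by lra.
  by apply: (iter_mono hK) => //; exact: cube1.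
have ub i : u i <= least_fixpoint K i.
  have lim : (1 - h) * iter n K (K (fun=> 0)) i + h * iter n K (fun=> 1) i
      @[n --> \oo] --> (1 - h) * least_fixpoint K i + h * greatest_fixpoint K i.
    apply: cvgD; apply: cvgMr; last exact: xc.
    have -> : (fun n => iter n K (K (fun=> 0)) i) = (fun n => iter n.+1 K (fun=> 0) i).
      by apply/funext => n; rewrite iterSr.
    by have := bc i; rewrite -[X in X -> _](cvg_shiftS (fun n => iter n K (fun=> 0) i)).
  suff : u i <= (1 - h) * least_fixpoint K i + h * greatest_fixpoint K i.
    by have := xu i; nra.
  by apply: (cvgr_to_ge lim); apply: nearW => n; exact: step.
move=> i; apply: le_trans (ub i) _; rewrite modified_extinctionE//.
have [m01 _ _ mF] := least_fixpointP
  (boundary_operator hp (modified_boundary A k l) (boundary_value_cube A)).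
(* The modified process is a supersolution for [K]: on frozen types, [u] is 0 in [A] and at most the
   sterile value 1 elsewhere. *)
apply: (least_fixpoint_le hK) => // j; rewrite /K.
have [Bj|Bj] := pselect (B j).
  rewrite boundary_op_in//; have [Aj|Aj] := pselect (A j).
    by rewrite uA//; case/andP: (m01 j).
  rewrite -(mF j) boundary_op_in; last by case: Bj => // lj; right.
  by rewrite /boundary_value asboolF//; case/andP: (u01 j).
by rewrite boundary_op_out// -[leRHS](mF j) boundary_op_out// =>
  -[[Aj _]|[_ lj]]; apply: Bj; [left|right].
Qed.

(* Within [n] generations the lower Hessenberg structure raises the level by at
   most [n], so no immortal type can have been produced. *)
Lemma iter_avoidance_le_modified A (k l : nat) :
  (forall i, avoidance p A i < 1) ->
  forall n i, (i.1 + n <= k)%N ->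
    iter n G (avoidance p A) i <= modified_extinction p A k%:Z l%:Z i.
Proof.
move=> u1; elim=> [|n IH] i ik; first exact: avoidance_le_modified.
have [u01 _ _] := avoidanceP hp A.
rewrite modified_extinctionE//=.
have [m01 _ _ mF] := least_fixpointP
  (boundary_operator hp (modified_boundary A k l) (boundary_value_cube A)).
rewrite -[leRHS](mF i).
have Gle : pgf p i (iter n G (avoidance p A)) <= pgf p i (least_fixpoint
   (bop (modified_boundary A k l) (boundary_value A))).
  apply: (pgf_le_local hp) => // [|j ji]; first exact: (iter_cube (pgf_operator hp)).
  rewrite -modified_extinctionE//; apply: IH.
  by rewrite (leq_trans _ ik)// addnS -addSn leq_add2r.
have [Bi|Bi] := pselect (modified_boundary A k l i); last by rewrite boundary_op_out.
rewrite boundary_op_in//; case: Bi => -[Ai ki].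
  by exfalso; apply: ki; rewrite /upto_level/= lez_nat (leq_trans _ ik)// leq_addr.
rewrite /boundary_value asboolF//.
by case/andP: (pgf_cube hp (iter_cube (pgf_operator hp) n u01) i).
Qed.

(* [D] plays the role of the immortal types (with [c = 0]), or of a single type
   at which the process is stopped. *)
Definition truncated_extinction A D c (l : nat) : typ d -> R :=
  least_fixpoint (bop (D `|` (~` A `&` ~` level_le l))
    (fun i => if `[< D i >] then c i else 1)).

Section Truncation.
Context (A D : set (typ d)) (c : typ d -> R).
Hypotheses (DA : D `<=` A) (c01 : in_unit_cube c).
Local Notation te := (truncated_extinction A D c).
Local Notation B l := (D `|` (~` A `&` ~` level_le l)).
Local Notation cc := (fun i => if `[< D i >] then c i else 1).

Let cc01 : in_unit_cube cc.
Proof. by move=> i; case: ifP => _; [exact: c01|rewrite ler01 lexx]. Qed.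

Lemma truncated_extinctionP l : [/\ in_unit_cube (te l),
  (forall i, D i -> te l i = c i),
  (forall i, ~ A i -> ~ level_le l i -> te l i = 1) &
  (forall i, ~ B l i -> te l i = pgf p i (te l))].
Proof.
have [t01 _ _ tF] := least_fixpointP (boundary_operator hp (B l) cc01).
split=> // i.
- by move=> Di; rewrite /te -[LHS](tF i) boundary_op_in ?asboolT//; left.
- move=> Ai li; rewrite /te -[LHS](tF i) boundary_op_in ?asboolF//; first by move/DA.
  by right.
- by move=> Bi; rewrite /te -[LHS](tF i) boundary_op_out.
Qed.

Lemma truncated_extinction_le l t : in_unit_cube t ->
  (forall i, D i -> c i <= t i) ->
  (forall i, ~ A i -> ~ level_le l i -> t i = 1) ->
  (forall i, ~ B l i -> pgf p i t <= t i) -> forall i, te l i <= t i.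
Proof.
move=> t01 tD t1 tG; apply: (least_fixpoint_le (boundary_operator hp (B l) cc01)) => // i.
have [Bi|Bi] := pselect (B l i); last by rewrite boundary_op_out ?tG.
rewrite boundary_op_in//; case: asboolP => [/tD//|Di].
by case: Bi => // -[Ai li]; rewrite t1.
Qed.

(** Passing to [l.+1] lets some sterile types reproduce. Their old value 1 dominates any value of
    [G], so the old solution is a supersolution of the new equations. *)
Lemma truncated_extinction_dec l i : te l.+1 i <= te l i.
Proof.
have [t01 tD t1 tG] := truncated_extinctionP l.
have lS j : ~ level_le l.+1 j -> ~ level_le l j.
  by rewrite /upto_level/= !lez_nat => h /leqW.
apply: truncated_extinction_le => // [j /tD->//|j Aj lj|j Bj].
  by rewrite t1//; exact: lS.
have [Bj'|Bj'] := pselect (B l j); last by rewrite [leRHS]tG.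
case: Bj' => [Dj|[Aj lj]]; first by exfalso; apply: Bj; left.
by rewrite t1//; case/andP: (pgf_cube hp t01 j).
Qed.

Definition limit_extinction := pointwise_lim te.
Local Notation r := limit_extinction.

Lemma limit_extinction_lim : [/\ in_unit_cube r,
  (forall i, te l i @[l --> \oo] --> r i) & (forall l i, r i <= te l i)].
Proof.
apply: nonincreasing_cube_lim; last exact: truncated_extinction_dec.
by move=> l; have [] := truncated_extinctionP l.
Qed.

Lemma limit_extinctionP : (forall i, D i -> r i = c i) /\
  (forall i, ~ D i -> r i = pgf p i r).
Proof.
have [r01 rc rle] := limit_extinction_lim.
split=> i Di; apply: (cvg_unique _ (rc i)) => //.
  have -> : (fun l => te l i) = (fun=> c i).
    by apply/funext => l; have [_ -> ] := truncated_extinctionP l.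
  exact: cvg_cst.
have c1 : pgf p i (te l) @[l --> \oo] --> pgf p i r.
  by apply: (pgf_cvg hp) => // l; have [] := truncated_extinctionP l.
(* As soon as [l >= i.1] the type [i] is not sterile, so the fixed point equation holds for all
   large [l]. *)
apply: cvg_trans c1; apply: near_eq_cvg; exists i.1 => // l /= il.
have [_ _ _ ->] := truncated_extinctionP l => //.
by move=> [//|[_]]; rewrite /upto_level/= lez_nat.
Qed.

Lemma limit_extinction_le_eventual (h : R) : 0 <= h < 1 ->
  (forall i, A i -> r i <= h) ->
  (forall i, D i -> c i <= eventual_avoidance p A i) ->
  forall i, r i <= eventual_avoidance p A i.
Proof.
move=> /andP[h0 h1] rA cD; have h01 : 0 <= h <= 1 by rewrite h0 ltW.
set q := eventual_avoidance p A in cD *; set u := avoidance p A.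
have [r01 rc rle] := limit_extinction_lim.
have [rD rG] := limit_extinctionP.
have [q01 _ _ qG] := eventual_avoidanceP hp A; rewrite -/q in q01 qG.
have hA := boundary_operator hp A (@cube0 R d).
(* Convexity along the iterates decreasing to [u], with value [h] on [A], where [u] vanishes and
   [r <= h]. *)
have ru i : r i <= (1 - h) * u i + h.
  have [_ uc _ _] := greatest_fixpointP hA.
  have lim : (1 - h) * iter n (bop A (fun=> 0)) (fun=> 1) i + h @[n --> \oo]
      --> (1 - h) * u i + h.
    by apply: cvgD; [apply: cvgMr; exact: uc|exact: cvg_cst].
  apply: (cvgr_to_ge lim); apply: nearW => n.
  elim: n i {lim} => [|n IH] i; first by rewrite /= mulr1 subrK; case/andP: (r01 i).
  have s01 := iter_cube hA n (@cube1 R d).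
  have [Ai|Ai] := pselect (A i).
    by rewrite /= boundary_op_in// mulr0 add0r rA.
  rewrite /= boundary_op_out//.
  rewrite [leLHS]rG; last by move/DA.
  have := @pgf_convex _ _ _ hp i _ (fun=> 1) h h01 s01 (@cube1 R d).
  rewrite pgf1// mulr1 => H; apply: le_trans (H _); last first.
    by move=> j; case/andP: (s01 j).
  apply: (pgf_mono hp) => // j.
  by have := cube_convex h01 s01 (@cube1 R d) j; rewrite mulr1.
have rq i : r i <= (1 - h) * q i + h.
  apply: (le_trans (ru i)); rewrite lerD2r ler_wpM2l ?subr_ge0 ?(ltW h1)//.
  exact: avoidance_le_eventual.
(* Letting [l] tend to infinity gives [r <= (1 - h) * q + h * r], and [h < 1] allows cancelling. *)
suff H l i : r i <= (1 - h) * q i + h * te l i.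
  move=> i; have lim : (1 - h) * q i + h * te l i @[l --> \oo] -->
      (1 - h) * q i + h * r i.
    by apply: cvgD; [exact: cvg_cst|apply: cvgMr; exact: rc].
  suff : r i <= (1 - h) * q i + h * r i by nra.
  by apply: (cvgr_to_ge lim); apply: nearW => l; exact: H.
have [t01 tD t1 tG] := truncated_extinctionP l.
(* The iterations [a], [b] and [f] share the boundary [B l] and the value [c] on [D]; on the sterile
   types their values are [q], [r] and 1, and [r <= (1 - h) * q + h] there. *)
pose qc j := if `[< D j >] then c j else q j.
have qc01 : in_unit_cube qc by move=> j; rewrite /qc; case: ifP.
have ha := boundary_operator hp (B l) qc01.
have hb := boundary_operator hp (B l) r01.
have hf := boundary_operator hp (B l) cc01.
pose a n := iter n (bop (B l) qc) (fun=> 0).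
pose b n := iter n (bop (B l) r) (fun=> 0).
pose f n := iter n (bop (B l) cc) (fun=> 0).
have a01 n : in_unit_cube (a n) by exact: (iter_cube ha n (@cube0 R d)).
have b01 n : in_unit_cube (b n) by exact: (iter_cube hb n (@cube0 R d)).
have f01 n : in_unit_cube (f n) by exact: (iter_cube hf n (@cube0 R d)).
have af n j : a n j <= f n j.
  elim: n j => //= n IH j; apply: (boundary_op_le hp) => // j' _.
  by rewrite /qc; case: ifP => // _; case/andP: (q01 j').
have aq n j : a n j <= q j.
  elim: n j => [|n IH] j; first by case/andP: (q01 j).
  rewrite /= /boundary_op; case: asboolP => _.
    by rewrite /qc; case: asboolP => // /cD.
  by rewrite -[leRHS]qG; exact: (pgf_mono hp).
have bcv n j : b n j <= (1 - h) * a n j + h * f n j.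
  elim: n j => [|n IH] j; first by rewrite /= !mulr0 addr0.
  rewrite /=; apply: (@le_trans _ _
    (bop (B l) r (fun i => (1 - h) * a n i + h * f n i) j)).
    by apply: (cube_op_mono hb) => //; exact: cube_convex.
  apply: (boundary_op_convex hp) => // _; rewrite /qc.
  by case: asboolP => [Dj|_]; [rewrite rD//; lra|rewrite mulr1].
(* Nothing yet says that [b n] converges to [r], which is merely a fixed point. Supermodularity
   bounds the defect [r - b n] by [te l - f n], which tends to 0 because [te l] is the least fixed
   point. *)
have H n j : [/\ b n j <= r j, b n j <= f n j <= te l j &
    r j - b n j <= te l j - f n j].
  elim: n j => [|n IH] j.
    rewrite /= !subr0; have /andP[-> _] := r01 j; have /andP[-> _] := t01 j.
    by rewrite lexx rle.
  rewrite /= /boundary_op; case: asboolP => Bj.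
    rewrite subrr; case: asboolP => Dj; first by rewrite rD// tD// subrr !lexx.
    case: Bj => // -[Aj lj]; rewrite t1// subrr !lexx/=.
    by have /andP[_ ->] := r01 j.
  rewrite tG// rG; last by move=> Dj; apply: Bj; left.
  split; first by apply: (pgf_mono hp) => // i'; have [] := IH i'.
    by apply/andP; split; apply: (pgf_mono hp) => // i'; have [_ /andP[]] := IH i'.
  apply: (pgf_increment hp) => // i'; have [? ? ?] := IH i'; split => //.
have [_ fc _ _] := least_fixpointP hf.
have lim : (1 - h) * q i + te l i - (1 - h) * f n i @[n --> \oo] -->
    (1 - h) * q i + te l i - (1 - h) * te l i.
  by apply: cvgB; [exact: cvg_cst|apply: cvgMr; exact: fc].
have -> : (1 - h) * q i + h * te l i =
  (1 - h) * q i + te l i - (1 - h) * te l i by ring.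
apply: (cvgr_to_ge lim); apply: nearW => n.
have [_ _ rb] := H n i; have ba := bcv n i.
have : (1 - h) * a n i <= (1 - h) * q i by rewrite ler_wpM2l ?subr_ge0 ?(ltW h1).
lra.
Qed.

End Truncation.
End UpperAndLowerBounds.

(** * Identification of the iterated limit *)

Section LimitIdentification.
Context {R : realType} {d : nat} (p : typ d -> offspring d -> R)
  (hp : lower_hessenberg_law p).
Implicit Types (A B C D : set (typ d)) (s t : typ d -> R).
Local Notation G := (fun s i => pgf p i s).
Local Notation level_le l := (upto_level d (Posz l)).
Local Notation bop := (boundary_op p).
Local Notation zero := ((fun=> 0) : typ d -> R).

Lemma modified_extinction_truncated A (k l : nat) :
  modified_extinction p A k%:Z l%:Z =
  truncated_extinction p A (A `&` ~` level_le k) zero l.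
Proof.
rewrite modified_extinctionE// /truncated_extinction; congr least_fixpoint.
apply/funext => s; apply/funext => i; rewrite /boundary_op /boundary_value.
rewrite -/(modified_boundary A k l); case: asboolP => // -[[Ai ki]|[Ai li]].
  by rewrite asboolT// asboolT.
by rewrite asboolF// asboolF// => -[].
Qed.

Definition limit_modified A (k : nat) : typ d -> R :=
  limit_extinction p A (A `&` ~` level_le k) zero.

Lemma modified_extinction_cvg A (k : nat) i :
  modified_extinction p A k%:Z l%:Z i @[l --> \oo] --> limit_modified A k i.
Proof.
have [_ c _] := limit_extinction_lim hp (@subIsetl _ A (~` level_le k)) (@cube0 R d).
under eq_cvg do rewrite modified_extinction_truncated; exact: c.
Qed.

Lemma avoidance_lt1 A : irreducible_law p -> A !=set0 ->
  forall i, avoidance p A i < 1.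
Proof.
move=> hirr [a Aa]; have [u01 uA _] := avoidanceP hp A.
apply: (lt1_of_le_pgf hp (b := a)) => //; first exact: avoidance_le_pgf.
by rewrite uA.
Qed.

Lemma iter_avoidance_le_limit A (k n : nat) i : irreducible_law p -> A !=set0 ->
  (i.1 + n <= k)%N -> iter n G (avoidance p A) i <= limit_modified A k i.
Proof.
move=> hirr A0 ik; apply: (cvgr_to_ge (@modified_extinction_cvg A k i)).
by apply: nearW => l; apply: iter_avoidance_le_modified => //; exact: avoidance_lt1.
Qed.

(** One value below 1 spreads to all types, hence uniformly over the finite set [T_k]. The types of
    [A] above level [k] have value 0, so a single [h < 1] bounds the limit on all of [A]. *)
Lemma limit_modified_le A (k : nat) b : irreducible_law p ->
  limit_modified A k b < 1 ->
  forall i, limit_modified A k i <= eventual_avoidance p A i.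
Proof.
move=> hirr rb; pose D := A `&` ~` level_le k.
have DA : D `<=` A by exact: subIsetl.
have [r01 _ _] := limit_extinction_lim hp DA (@cube0 R d).
have [rD rG] := limit_extinctionP hp DA (@cube0 R d).
have r1 := lt1_of_le_pgf hp hirr r01 _ rb.
have {}r1 i : limit_modified A k i < 1.
  apply: r1 => j; have [Dj|Dj] := pselect (D j).
    by rewrite rD//; case/andP: (pgf_cube hp r01 j).
  by rewrite [leLHS]rG.
have [h h01 rh] := uniform_lt1 (finite_level_le k) r01 (fun i _ => r1 i).
apply: (limit_extinction_le_eventual hp DA (@cube0 R d) h01) => i Ai.
  have [ki|ki] := pselect (level_le k i); first exact: rh.
  by rewrite rD//; case/andP: h01.
by have [q01 _ _ _] := eventual_avoidanceP hp A; case/andP: (q01 i).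
Qed.

(** Let [e] be the probability of dying out. It is at least [1 - h > 0] on the finite set [A], so a
    visit to [A] at or after generation [n] has probability at most [(1 - h)^-1] times that of dying
    after generation [n], which tends to 0. *)
Lemma eventual_avoidance_unary A j r0 : irreducible_law p -> finite_set A ->
  (forall i r, p i r != 0 -> (\sum_(l <- finsupp r) r l <= 1)%N) ->
  p j r0 != 0 -> (\sum_(l <- finsupp r0) r0 l = 0)%N ->
  forall i, eventual_avoidance p A i = 1.
Proof.
move=> hirr finA r1 pr0 r00; have hG := pgf_operator hp.
pose e := least_fixpoint G.
have [e01 ec _ eG] := least_fixpointP hG; rewrite -/e in e01 ec eG.
have pgf_gt0 i s r : in_unit_cube s -> p i r != 0 ->
    0 < \prod_(l <- population_seq r) s l -> 0 < pgf p i s.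
  move=> s01 pr sr.
  have := @pgf_comb_lt _ _ _ hp i 0 0 1 0 s s s s r (lexx _) (lexx _) ler01 (lexx _)
    s01 s01 s01 s01.
  rewrite !mul0r !mul1r !addr0; apply => // r' _.
  by rewrite !mul0r mul1r !addr0; case/andP: (prod_cube (population_seq r') s01).
have e0 : forall i, 0 < e i.
  apply: (irreducible_ind hirr (j := j)) => [|x y /mean_offspring_gt0[r pr ry] ey].
    rewrite -eG; apply: (pgf_gt0 _ _ r0) => //.
    by move: r00; rewrite -size_population => /size0nil ->; rewrite big_nil.
  rewrite -eG; apply: (pgf_gt0 _ _ r) => //.
  have := r1 _ _ pr; rewrite -size_population -mem_population in ry *.
  case: (population_seq r) ry => [|y' [|]]//=.
  by rewrite mem_seq1 => /eqP <- _; rewrite big_seq1.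
have c01 : in_unit_cube (fun i => 1 - e i).
  by move=> i; have /andP[? ?] := e01 i; apply/andP; split; lra.
have [|h /andP[h0 h1] hA] := uniform_lt1 finA c01.
  by move=> i _; have := e0 i; lra.
have d0 : 0 <= 1 - h by lra.
have [u01 _ _] := avoidanceP hp A; set u := avoidance p A in u01.
have hop := boundary_operator hp A (@cube0 R d).
have ue i : (1 - h) * (1 - u i) <= e i.
  have [_ uc _ _] := greatest_fixpointP hop.
  have lim : (1 - h) * (1 - iter n (bop A zero) (fun=> 1) i) @[n --> \oo] -->
      (1 - h) * (1 - u i).
    by apply: cvgMr; apply: cvgB; [exact: cvg_cst|exact: uc].
  apply: (cvgr_to_le lim); apply: nearW => n.
  elim: n i {lim} => [|n IH] i.
    by rewrite /= subrr mulr0; case/andP: (e01 i).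
  rewrite /= /boundary_op; case: asboolP => [/hA|_]; first by lra.
  have := @pgf_unary _ _ _ hp i _ e zero (1 - h) d0 (r1 i)
    (iter_cube hop n (@cube1 R d)) e01 (@cube0 R d).
  rewrite eG => H; apply: (@le_trans _ _ (e i - pgf p i zero)); last first.
    by rewrite gerBl; case/andP: (pgf_cube hp (@cube0 R d) i).
  by apply: H => l; rewrite subr0.
have H n i : (1 - h) * (1 - iter n G u i) <= e i - iter n G zero i.
  elim: n i => [|n IH] i; first by rewrite /= subr0.
  rewrite /= -[e i]eG; apply: (pgf_unary hp) => //.
  - exact: r1.
  - exact: (iter_cube hG).
  - exact: (iter_cube hG n (@cube0 R d)).
move=> i; have [q01 qc _ _] := eventual_avoidanceP hp A.
have l1 : (1 - h) * (1 - iter n G u i) @[n --> \oo] -->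
    (1 - h) * (1 - eventual_avoidance p A i).
  by apply: cvgMr; apply: cvgB; [exact: cvg_cst|exact: qc].
have l2 : e i - iter n G zero i @[n --> \oo] --> e i - e i.
  by apply: cvgB; [exact: cvg_cst|exact: ec].
have : (1 - h) * (1 - eventual_avoidance p A i) <= e i - e i.
  by apply: (ler_cvg_to l1 l2); apply: nearW => n; exact: H.
have /andP[? ?] := q01 i; rewrite subrr pmulr_rle0 ?subr_gt0// subr_le0 => ?.
by apply/eqP; rewrite eq_le; apply/andP.
Qed.

(** The union bound passes through [G]: it is propagated first along the iterates defining
    [avoidance], then along those defining [eventual_avoidance]. It reduces finite sets to single
    points. *)
Lemma eventual_avoidance_union A B i :
  eventual_avoidance p A i + eventual_avoidance p B i <=
  eventual_avoidance p (A `|` B) i + 1.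
Proof.
have hG := pgf_operator hp.
have u_le j : avoidance p A j + avoidance p B j <= avoidance p (A `|` B) j + 1.
  have [_ cA _ _] := greatest_fixpointP (boundary_operator hp A (@cube0 R d)).
  have [_ cB _ _] := greatest_fixpointP (boundary_operator hp B (@cube0 R d)).
  have [_ cU _ _] := greatest_fixpointP (boundary_operator hp (A `|` B) (@cube0 R d)).
  pose u C n := iter n (bop C zero) (fun=> 1).
  have lAB : u A n j + u B n j @[n --> \oo] --> avoidance p A j + avoidance p B j.
    by apply: cvgD; [exact: cA|exact: cB].
  have lU : u (A `|` B) n j + 1 @[n --> \oo] --> avoidance p (A `|` B) j + 1.
    by apply: cvgD; [exact: cU|exact: cvg_cst].
  apply: (ler_cvg_to lAB lU).
  apply: nearW => n; elim: n j {lAB lU} => [//|n IH] j.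
  have A01 := iter_cube (boundary_operator hp A (@cube0 R d)) n (@cube1 R d).
  have B01 := iter_cube (boundary_operator hp B (@cube0 R d)) n (@cube1 R d).
  have U01 := iter_cube (boundary_operator hp (A `|` B) (@cube0 R d)) n (@cube1 R d).
  have /andP[gA0 gA1] := pgf_cube hp A01 j; have /andP[gB0 gB1] := pgf_cube hp B01 j.
  rewrite /= /boundary_op.
  case: (asboolP (A j)) => Aj.
    by rewrite (asboolT (or_introl Aj : (A `|` B) j)) !add0r; case: ifP.
  case: (asboolP (B j)) => Bj.
    by rewrite (asboolT (or_intror Bj : (A `|` B) j)) addr0 add0r.
  by rewrite asboolF; [exact: (pgf_union_bound hp)|case].
have [_ cA _ _] := eventual_avoidanceP hp A.
have [_ cB _ _] := eventual_avoidanceP hp B.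
have [_ cU _ _] := eventual_avoidanceP hp (A `|` B).
pose v C n := iter n G (avoidance p C).
have lAB : v A n i + v B n i @[n --> \oo] -->
    eventual_avoidance p A i + eventual_avoidance p B i.
  by apply: cvgD; [exact: cA|exact: cB].
have lU : v (A `|` B) n i + 1 @[n --> \oo] --> eventual_avoidance p (A `|` B) i + 1.
  by apply: cvgD; [exact: cU|exact: cvg_cst].
apply: (ler_cvg_to lAB lU).
apply: nearW => n; elim: n i {lAB lU} => [//|n IH] i /=.
have v01 C : in_unit_cube (v C n).
  by have [u01 _ _] := avoidanceP hp C; exact: (iter_cube hG).
exact: (pgf_union_bound hp _ (v01 A) (v01 B) (v01 _) IH).
Qed.

Lemma eventual_avoidance_finite A i : finite_set A ->
  (forall a, A a -> eventual_avoidance p [set a] i = 1) ->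
  eventual_avoidance p A i = 1.
Proof.
move=> /finite_seqP[l ->]; elim: l => [_|x l IH H].
  have u1 j : 1 <= avoidance p [set` [::]] j.
    have hop := boundary_operator hp [set` [::] : seq (typ d)] (@cube0 R d).
    apply: (greatest_fixpoint_ge hop (@cube1 R d)) => k.
    by rewrite boundary_op_out// pgf1.
  apply/eqP; rewrite eq_le; have [q01 _ _ _] := eventual_avoidanceP hp [set` [::]].
  have /andP[_ ->] := q01 i.
  exact: (le_trans (u1 i) (avoidance_le_eventual hp _ _)).
have := eventual_avoidance_union [set x] [set` l] i.
have -> : [set x] `|` [set` l] = [set` x :: l].
  apply/seteqP; split=> y /=; rewrite in_cons.
    by case=> [->|->]; rewrite ?eqxx ?orbT.
  by move=> /predU1P[|]; [left|right].
rewrite H /= ?mem_head// IH; last by move=> a al; apply: H; rewrite /= in_cons al orbT.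
have [q01 _ _ _] := eventual_avoidanceP hp [set` x :: l].
have /andP[_ ?] := q01 i => ?.
by apply/eqP; rewrite eq_le; apply/andP; split; lra.
Qed.

Lemma eventual_avoidance_branching A (K : nat) j r0 a : irreducible_law p ->
  p j r0 != 0 -> (1 < \sum_(l <- finsupp r0) r0 l)%N ->
  A `<=` level_le K -> A a -> (forall i, limit_modified A K i = 1) ->
  forall i, eventual_avoidance p [set a] i = 1.
Proof.
move=> hirr pr0 r02 AK Aa rK; apply: contrapT => /existsNP[b /eqP zb].
set z := eventual_avoidance p [set a] in zb.
have [z01 _ _ zG] := eventual_avoidanceP hp [set a]; rewrite -/z in z01 zG.
have z1 : forall i, z i < 1.
  apply: (lt1_of_le_pgf hp (b := b)) => //.
    by move=> i; rewrite zG.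
  by rewrite lt_neqAle zb; case/andP: (z01 b).
have hG := pgf_operator hp.
pose h : R := 2^-1; have h01 : 0 < h < 1 by rewrite /h; apply/andP; split; lra.
have h01' : 0 <= h <= 1 by rewrite /h; apply/andP; split; lra.
(* A point on the segment from [z] to the fixed point [1]; strict convexity
   makes it a strict supersolution, contradicting extinction of all truncations. *)
pose w i := (1 - h) * z i + h.
have w01 : in_unit_cube w.
  by move=> i; have := cube_convex h01' z01 (@cube1 R d) i; rewrite mulr1.
have w0 i : 0 < w i.
  by have /andP[z0 _] := z01 i; rewrite /w; have /andP[? ?] := h01; nra.
have wa1 : w a < 1 by have := z1 a; rewrite /w; have /andP[? ?] := h01; nra.
have aa : [set a] `<=` [set a] by [].
pose x0 := limit_extinction p [set a] [set a] z.
pose x := limit_extinction p [set a] [set a] w.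
have [_ x0c _] := limit_extinction_lim hp aa z01.
have [x0D _] := limit_extinctionP hp aa z01.
have [x01 xc _] := limit_extinction_lim hp aa w01.
have [xD xG] := limit_extinctionP hp aa w01.
rewrite -/x in x01 xc xD xG; rewrite -/x0 in x0c x0D.
(* The upper bound is applied to the set [[set a]] itself, with [h = z a]. *)
have x0z i : x0 i <= z i.
  apply: (limit_extinction_le_eventual hp aa z01 (h := z a)).
  - by rewrite z1 andbT; case/andP: (z01 a).
  - by move=> _ ->; rewrite -/x0 x0D.
  - by [].
(* Raising the stopping value from [z a] to [w a] costs at most the convex combination with 1, since
   sterile types already have value 1. *)
have xw i : x i <= w i.
  apply: (@le_trans _ _ ((1 - h) * x0 i + h)); last first.
    by rewrite /w lerD2r ler_wpM2l// subr_ge0; case/andP: h01'.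
  have lim : (1 - h) * truncated_extinction p [set a] [set a] z l i + h
      @[l --> \oo] --> (1 - h) * x0 i + h.
    by apply: cvgD; [apply: cvgMr; exact: x0c|exact: cvg_cst].
  apply: (ler_cvg_to (xc i) lim); apply: nearW => l.
  have [t01 tD t1 tG] := truncated_extinctionP hp aa z01 l.
  apply: (truncated_extinction_le hp w01 (t := fun k =>
    (1 - h) * truncated_extinction p [set a] [set a] z l k + h)) => [k|k|k ka kl|k Bk].
  - by have := cube_convex h01' t01 (@cube1 R d) k; rewrite mulr1.
  - by move=> ka; rewrite tD// /w.
  - by rewrite t1// mulr1 subrK.
  - rewrite [in leRHS]tG//.
    have := @pgf_convex _ _ _ hp k _ (fun=> 1) h h01' t01 (@cube1 R d).
    rewrite pgf1// mulr1.
    by apply => m; case/andP: (t01 m).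
have Gax : w a <= pgf p a x.
  have lim : pgf p a (truncated_extinction p [set a] [set a] w l) @[l --> \oo]
      --> pgf p a x.
    by apply: (pgf_cvg hp) => // l; have [] := truncated_extinctionP hp aa w01 l.
  apply: (cvgr_to_ge lim); exists K => // l /= Kl.
  (* Otherwise the process stopped at [a] gives a supersolution for the original truncation, whose
     limit value at [a] is 1 by [rK]; this would force [1 <= w a]. *)
  rewrite leNgt; apply/negP => Ga.
  have [t01 tD t1 tG] := truncated_extinctionP hp aa w01 l.
  have AKl i : A i -> level_le l i.
    by move=> /AK; rewrite /upto_level/= !lez_nat => /leq_trans; apply.
  have : 1 <= w a; last by rewrite leNgt wa1.
  rewrite -(tD a)// -(rK a).
  have [_ _ rle] := limit_extinction_lim hp (@subIsetl _ A (~` level_le K)) (@cube0 R d).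
  apply: (le_trans (rle l a)).
  rewrite -modified_extinction_truncated modified_extinctionE//.
  apply: (least_fixpoint_le (boundary_operator hp _ (boundary_value_cube A))) => // i.
  have [Bi|Bi] := pselect (modified_boundary A K l i).
    rewrite boundary_op_in//; case: Bi => -[Ai li].
      by rewrite /boundary_value asboolT//; case/andP: (t01 i).
    rewrite t1//; last by move=> ia; apply: Ai; rewrite ia.
    by case/andP: (boundary_value_cube (R := R) A i).
  rewrite boundary_op_out//; have [->|ia] := pselect (i = a).
    by rewrite tD// ltW.
  rewrite [leRHS]tG// => -[//|[_ li]]; apply: Bi; right; split=> // /AKl.
  exact: li.
have xGx i : x i <= pgf p i x.
  have [->|ia] := pselect (i = a); first by rewrite xD.
  by rewrite [leLHS]xG.
have wG i : pgf p i w <= w i.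
  have := @pgf_convex _ _ _ hp i _ (fun=> 1) h h01' z01 (@cube1 R d).
  rewrite pgf1// zG mulr1.
  by apply => m; exact: ltW.
have iw n : in_unit_cube (iter n G w) by exact: (iter_cube hG).
have wn n i : iter n G w i <= w i.
  elim: n i => // n IH i; apply: le_trans (wG i) => /=.
  exact: (pgf_mono hp).
have xn n i : x i <= iter n G w i.
  elim: n i => [|n IH] i; first exact: xw.
  by apply: (le_trans (xGx i)) => /=; exact: (pgf_mono hp).
(* Branching at [j] makes [G w < w] strict there. The strictness moves backward along edges, one
   generation per edge, up to [a]; but [w a = x a <= iter n G w a]. *)
have [n] : exists n, iter n G w a < w a.
  apply: (irreducible_ind hirr (Q := fun i => exists n, iter n G w i < w i) (j := j)).
    exists 1%N => /=; rewrite [ltRHS]/w -[z j]zG.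
    apply: (pgf_strictly_convex hp h01 _ pr0 r02) => i.
    by rewrite z1; case/andP: (z01 i) => ->.
  move=> y y' yy' [n nw]; exists n.+1 => /=; apply: (lt_le_trans _ (wG y)).
  exact: (pgf_lt hp _ _ (wn n) w0 yy' nw).
by rewrite ltNge -(xD a)// xn.
Qed.

(** The conditions on [A] exclude genuine failures. For empty [A] the right side is 1, while the
    left is the limiting extinction probability of the truncations, possibly smaller. For finite
    nonempty [A] and a recurrent single-particle chain, the right side is 0, yet every truncation
    dies out. *)
Theorem limit_modified_cvg A : irreducible_law p -> A !=set0 ->
  infinite_set A \/ nonsingular_law p ->
  forall i, limit_modified A k i @[k --> \oo] --> eventual_avoidance p A i.
Proof.
move=> hirr A0 hsing i.
have [K hK] : exists K, forall k, (K <= k)%N ->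
    limit_modified A k i <= eventual_avoidance p A i.
  have [q01 _ _ _] := eventual_avoidanceP hp A.
  have r01 k : in_unit_cube (limit_modified A k).
    by have [] := limit_extinction_lim hp (@subIsetl _ A (~` level_le k)) (@cube0 R d).
  have [finA|infA] := pselect (finite_set A); last first.
    exists 0%N => k _.
    (* An infinite [A] has immortal types above every level [k], and the limit vanishes there. *)
    have [b [Ab kb]] : (A `&` ~` level_le k) !=set0.
      apply: contrapT => /set0P/negP/negPn/eqP A0'; apply: infA.
      apply: (sub_finite_set _ (finite_level_le k)) => b Ab.
      by apply: contrapT => kb; have : set0 b by rewrite -A0'.
    apply: (limit_modified_le (b := b)) => //.
    have [rD _] := limit_extinctionP hp (@subIsetl _ A (~` level_le k)) (@cube0 R d).
    by rewrite /limit_modified rD.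
  have [j [r0 [pr0 r01']]] : nonsingular_law p by case: hsing.
  have [K AK] : exists K : nat, A `<=` level_le K.
    have [l Al] := (finite_seqP A).1 finA.
    exists (\max_(x <- l) x.1)%N => x; rewrite Al /upto_level/= lez_nat => xl.
    by rewrite (big_rem x xl)/= leq_maxl.
  exists K => k Kk; have {}AK : A `<=` level_le k.
    by move=> x /AK; rewrite /upto_level/= !lez_nat => /leq_trans; apply.
  have [[b rb]|r1] := pselect (exists b, limit_modified A k b < 1).
    exact: limit_modified_le rb i.
  have {}r1 b : limit_modified A k b = 1.
    apply/eqP; rewrite eq_le; have /andP[_ ->] := r01 k b.
    by rewrite leNgt; apply/negP => rb; apply: r1; exists b.
  suff -> : eventual_avoidance p A i = 1 by have /andP[] := r01 k i.
  have [[j' [r' [pr' r2]]]|unary] := pselect (exists j' r', p j' r' != 0 /\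
      (1 < \sum_(l <- finsupp r') r' l)%N).
    apply: eventual_avoidance_finite => // a Aa.
    exact: (eventual_avoidance_branching hirr pr' r2 AK Aa r1).
  have {}unary j' r' : p j' r' != 0 -> (\sum_(l <- finsupp r') r' l <= 1)%N.
    by move=> pr'; rewrite leqNgt; apply/negP => r2; apply: unary; exists j', r'.
  apply: (eventual_avoidance_unary hirr finA unary pr0).
  by have := unary _ _ pr0; case: (\sum_(l <- _) _)%N r01' => [|[|]].
have [_ qc _ _] := eventual_avoidanceP hp A.
apply/cvgrPdist_le => e e0.
move/cvgrPdist_le: (qc i) => /(_ _ e0)[n _ /(_ n (leqnn n))].
rewrite ler_norml => /andP[_ qn].
(* Taking [k >= i.1 + n] makes the bound by the [n]-th iterate available; [k >= K] gives the upper
   bound. *)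
exists (maxn K (i.1 + n)) => // k /=; rewrite geq_max => /andP[/hK kq ik].
have := iter_avoidance_le_limit hirr A0 ik.
by rewrite ler_norml => ?; apply/andP; split; lra.
Qed.

End LimitIdentification.

(** * Countable partitions of the sample space *)

Section CountablePartitions.
Context {R : realType} {disp : measure_display} {Omega : measurableType disp}.

(** Countable additivity over the fibres of [f], indexed by natural numbers through [pickle];
    numbers that code no value index the empty set. *)
Lemma measure_partition (C : countType) (Q : probability Omega R)
    (f : Omega -> C) (X : set Omega) :
  (forall c, measurable (X `&` [set w | f w = c])) ->
  measurable X /\ Q X = (\esum_(c in [set: C]) Q (X `&` [set w | f w = c]))%E.
Proof.
move=> mX; pose F n := X `&` [set w | choice.pickle (f w) = n].
have Fpickle c : F (choice.pickle c) = X `&` [set w | f w = c].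
  by apply/seteqP; split=> w [Xw /= fw]; split=> //=;
    [exact: (pcan_inj choice.pickleK) fw|rewrite fw].
have F0 n : ~ range (@choice.pickle C) n -> F n = set0.
  by move=> nC; apply/seteqP; split=> // w [_ /= fw]; apply: nC; exists (f w).
have mF n : measurable (F n).
  have [[c _ <-]|/F0 ->//] := pselect (range (@choice.pickle C) n).
  by rewrite Fpickle.
have XF : X = \bigcup_n F n.
  by apply/seteqP; split=> [w Xw|w [n _ []]//]; exists (choice.pickle (f w)).
split; first by rewrite XF; exact: bigcupT_measurable.
rewrite {1}XF measure_bigcup//; last first.
  by move=> m n _ _ [w [[_ /= <-] [_ /= <-]]].
rewrite nneseries_esum//= (_ : [set x | x \in [set: nat]] = setT); last first.
  by apply/seteqP; split=> // x _; rewrite /= in_setT.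
rewrite (esumID (range (@choice.pickle C)))//= [X in (_ + X)%E]esum1 ?adde0; last first.
  by move=> n [_ /F0 ->]; rewrite measure0.
rewrite setTI esum_image; last by move=> x y _ _; exact: (pcan_inj choice.pickleK).
by apply: eq_esum => c _; rewrite Fpickle.
Qed.

Lemma probability1_setI (Q : probability Omega R) (A X : set Omega) :
  measurable A -> measurable X -> Q A = 1%E -> Q (A `&` X) = Q X.
Proof.
move=> mA mX QA.
have Q0 : Q (X `\` A) = 0%E.
  apply: (subset_measure0 (measurableD mX mA) (measurableC mA)) => [w []//|].
  by have := probability_setC Q mA; rewrite QA subee.
rewrite -[in RHS](setUIDK X A) measureU0 1?setIC//.
- exact: measurableI.
- exact: measurableD.
Qed.

(** The values of the variables [X u] are summed out one at a time, turning a sum of products into a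
    product of sums. Measurability of [B] meeting [E] is recovered from the fibres along the way. *)
Lemma measure_peel (V : eqType) (C : countType) (Q : probability Omega R)
    (X : V -> Omega -> C) (wgt : V -> C -> R) (S : V -> R) (c0 : C)
    (U : seq V) (E B : set Omega) (K : R) :
  uniq U -> 0 <= K -> (forall u c, 0 <= wgt u c) ->
  (forall u, (\esum_(c in [set: C]) (wgt u c)%:E = (S u)%:E)%E) ->
  (forall r : V -> C,
    measurable (B `&` [set w | forall u, u \in U -> X u w = r u] `&` E) /\
    Q (B `&` [set w | forall u, u \in U -> X u w = r u] `&` E) =
      (K * \prod_(u <- U) wgt u (r u))%:E) ->
  measurable (B `&` E) /\ Q (B `&` E) = (K * \prod_(u <- U) S u)%:E.
Proof.
move=> uU K0 wgt0 wgtS; elim: U B K K0 uU => [|u U IH] B K K0 /=.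
  move=> _ /(_ (fun=> c0)); rewrite !big_nil.
  by rewrite (_ : [set w | _] = setT) ?setIT//; apply/seteqP; split.
move=> /andP[uU unU] H.
have step c : measurable (B `&` E `&` [set w | X u w = c]) /\
    Q (B `&` E `&` [set w | X u w = c]) =
      (K * \prod_(v <- U) S v * wgt u c)%:E.
  rewrite setIAC mulrAC; apply: IH => //; first exact: mulr_ge0.
  move=> r; have := H (fun v => if v == u then c else r v).
  rewrite big_cons eqxx.
  have -> : \prod_(v <- U) wgt v (if v == u then c else r v) =
      \prod_(v <- U) wgt v (r v).
    apply: eq_big_seq => v vU; case: eqVneq => // vu.
    by rewrite vu (negPf uU) in vU.
  have -> : B `&` [set w | forall v, v \in u :: U ->
      X v w = if v == u then c else r v] =
      B `&` [set w | X u w = c] `&` [set w | forall v, v \in U -> X v w = r v].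
    apply/seteqP; split=> w.
      move=> [Bw /= h]; split; first by split=> //=; rewrite h ?mem_head// eqxx.
      move=> v vU; rewrite h ?in_cons ?vU ?orbT//; case: eqVneq => // vu.
      by rewrite vu (negPf uU) in vU.
    move=> [[Bw /= h] h']; split=> //= v; rewrite in_cons.
    by case: eqVneq => [->//|_ /= /h'].
  by rewrite mulrA.
have [mX ->] := measure_partition Q (fun c => (step c).1).
split=> //; have P0 : 0 <= K * \prod_(v <- U) S v.
  rewrite mulr_ge0// prodr_ge0// => v _; rewrite -lee_fin -wgtS.
  by apply: esum_ge0 => c _; rewrite lee_fin.
under eq_esum do rewrite (step _).2.
have esumZ' : (\esum_(c in [set: C]) (K * \prod_(v <- U) S v * wgt u c)%:E =
    (K * \prod_(v <- U) S v)%:E * \esum_(c in [set: C]) (wgt u c)%:E)%E.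
  by apply: esum_scale.
by rewrite esumZ' wgtS big_cons -EFinM; congr EFin; ring.
Qed.

End CountablePartitions.

(** * The branching property for finitely many generations *)

Section ProcessLaw.
Context {R : realType} {d : nat} {disp : measure_display}
  {Omega : measurableType disp}.
Context (p : typ d -> offspring d -> R) (P : typ d -> probability Omega R)
  (phi0 : Omega -> typ d) (xi : nat -> typ d -> nat -> Omega -> offspring d)
  (hp : lower_hessenberg_law p) (hZ : branching_process p P phi0 xi).
Local Notation G := (fun s i => pgf p i s).
Local Notation Z := (generation phi0 xi).
Local Notation label := (nat * typ d * nat)%type.

Definition individuals (n : nat) (z : offspring d) : seq label :=
  [seq (n, j, m) | j <- finsupp z, m <- iota 0 (z j)].

Lemma mem_individuals n z u :
  (u \in individuals n z) = (u.1.1 == n) && (u.2 < z u.1.2)%N.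
Proof.
apply/allpairsPdep/andP => [[j [m [_ + ->]]]|[]] /=.
  by rewrite mem_iota eqxx.
case: u => [[n' j] m] /= /eqP -> mz; exists j, m.
by rewrite mem_finsupp -lt0n (leq_ltn_trans _ mz)// mem_iota.
Qed.

Lemma individuals_uniq n z : uniq (individuals n z).
Proof.
apply: allpairs_uniq_dep; first exact: fset_uniq.
  by move=> j _; exact: iota_uniq.
by move=> [j m] [j' m'] _ _ /= [-> ->].
Qed.

Lemma prod_individuals n z (f : typ d -> R) :
  \prod_(u <- individuals n z) f u.1.2 = \prod_(j <- population_seq z) f j.
Proof.
rewrite big_allpairs_dep -prod_population; apply: eq_bigr => j _ /=.
by rewrite big_const_seq count_predT size_iota -Monoid.iteropE.
Qed.

Definition progeny (U : seq label) (r : label -> offspring d) : offspring d :=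
  [fsfun l in seq_fset tt (flatten [seq enum_fset (finsupp (r u)) | u <- U]) =>
    (\sum_(u <- U) r u l)%N].

Lemma progenyE U r l : progeny U r l = (\sum_(u <- U) r u l)%N.
Proof.
rewrite /progeny fsfunE seq_fsetE; case: ifPn => // lU.
rewrite big_seq big1// => u uU; apply/eqP; rewrite -memNfinsupp.
by apply: contra lU => lu; apply/flatten_mapP; exists u.
Qed.

Lemma prod_progeny U r (f : typ d -> R) :
  \prod_(l <- population_seq (progeny U r)) f l =
  \prod_(u <- U) \prod_(l <- population_seq (r u)) f l.
Proof.
pose X := seq_fset tt (flatten [seq enum_fset (finsupp (r u)) | u <- U]).
have widen z : (finsupp z `<=` X)%fset ->
    \prod_(l <- population_seq z) f l = \prod_(l <- X) f l ^+ z l.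
  move=> zX; rewrite -prod_population; apply: big_fset_incl => // l _.
  by rewrite memNfinsupp => /eqP ->.
rewrite widen; last first.
  apply/fsubsetP => l; rewrite mem_finsupp; apply: contraR => lX.
  by rewrite /progeny fsfunE ifN.
have -> : \prod_(u <- U) \prod_(l <- population_seq (r u)) f l =
    \prod_(u <- U) \prod_(l <- X) f l ^+ r u l.
  apply: eq_big_seq => u uU; apply: widen; apply/fsubsetP => l lu.
  by rewrite seq_fsetE; apply/flatten_mapP; exists u.
rewrite exchange_big/=; apply: eq_bigr => l _.
by rewrite progenyE -expr_sum.
Qed.

(** Given the census [z] and the offspring of its individuals, the next census is deterministic. The
    sum over all types becomes one over a finite list of labels. *)
Lemma generationS n w (z : offspring d) (r : label -> offspring d) :
  (forall l, Z n w l = z l) ->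
  (forall u, u \in individuals n z -> xi u.1.1 u.1.2 u.2 w = r u) ->
  forall l, Z n.+1 w l = progeny (individuals n z) r l.
Proof.
move=> Zz xr l; rewrite progenyE big_allpairs_dep/=.
rewrite (fsbigTE (finsupp z)); last first.
  by move=> j; rewrite memNfinsupp => /eqP zj; rewrite Zz zj big_ord0.
apply: eq_bigr => j _; rewrite Zz.
rewrite [RHS](_ : _ = (\sum_(0 <= m < z j) r (n, j, m) l)%N); last first.
  by rewrite /index_iota subn0.
rewrite big_mkord; apply: eq_bigr => m _.
by rewrite -xr// mem_individuals /= eqxx ltn_ord.
Qed.

(** The Markov property in cylinder form: [B] is independent of the offspring vectors of generations
    [n] and later. *)
Definition indep_future i n (B : set Omega) :=
  forall (J : {fset label}) (r : label -> offspring d),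
  (forall u, u \in J -> (n <= u.1.1)%N) ->
  P i (B `&` \bigcap_(u in [set` J]) [set w | xi u.1.1 u.1.2 u.2 w = r u]) =
  (P i B * (\prod_(u <- J) p u.1.2 (r u))%:E)%E.

Lemma indep_future_start i : indep_future i 0 [set w | phi0 w = i].
Proof.
move=> J r _; set X := \bigcap_(u in _) _.
have mi := phi0_measurable hZ i.
have mX : measurable X.
  rewrite /X bigcap_fset; apply: bigsetI_measurable => u _.
  exact: (xi_measurable hZ).
rewrite probability1_setI//; last exact: (phi0_start hZ).
rewrite (phi0_start hZ) mul1e (xi_independent hZ) -prodEFin.
by apply: eq_bigr => u _; exact: (xi_law hZ).
Qed.

Lemma bigcap_individuals n z (r : label -> offspring d) :
  \bigcap_(u in [set` [fset u in individuals n z]%fset])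
      [set w | xi u.1.1 u.1.2 u.2 w = r u] =
  [set w | forall u, u \in individuals n z -> xi u.1.1 u.1.2 u.2 w = r u].
Proof.
apply/seteqP; split=> w /= h u; first by move=> uU; apply: h; rewrite /= inE.
by rewrite /= inE => uU; exact: h.
Qed.

Lemma prod_individuals_fset n z (f : label -> R) :
  \prod_(u <- [fset u in individuals n z]%fset) f u =
  \prod_(u <- individuals n z) f u.
Proof.
apply: perm_big; apply: uniq_perm; rewrite ?fset_uniq ?individuals_uniq//.
by move=> u; rewrite inE.
Qed.

(** The labels of generation [n] are disjoint from those of later generations, so both families
    merge into one finite set (with values glued in [r'']) on which independence of [B] applies. *)
Lemma indep_future_step i n z (r : label -> offspring d) B :
  indep_future i n B ->
  let B' := B `&` [set w | forall u, u \in individuals n z ->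
    xi u.1.1 u.1.2 u.2 w = r u] in
  indep_future i n.+1 B' /\
  P i B' = (P i B * (\prod_(u <- individuals n z) p u.1.2 (r u))%:E)%E.
Proof.
move=> iB B'; pose U := [fset u in individuals n z]%fset.
have Un u : u \in U -> u.1.1 = n.
  by rewrite inE mem_individuals => /andP[/eqP].
have PB' : P i B' = (P i B * (\prod_(u <- individuals n z) p u.1.2 (r u))%:E)%E.
  rewrite /B' -bigcap_individuals iB ?prod_individuals_fset// => u /Un ->.
  exact: leqnn.
split=> // J r' Jn; rewrite PB' -muleA -EFinM.
pose r'' u := if u \in U then r u else r' u.
have nJ u : u \in J -> u \notin U.
  by move=> /Jn nu; apply/negP => /Un un; rewrite un ltnn in nu.
have := iB (U `|` J)%fset r''.
have -> : B `&` \bigcap_(u in [set` (U `|` J)%fset])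
    [set w | xi u.1.1 u.1.2 u.2 w = r'' u] =
    B' `&` \bigcap_(u in [set` J]) [set w | xi u.1.1 u.1.2 u.2 w = r' u].
  rewrite /B' -bigcap_individuals -/U; apply/seteqP; split=> w.
    move=> [Bw h]; split; first split=> // u /= uU.
      by have := h u; rewrite /= inE uU /r'' uU; apply.
    by move=> u /= uJ; have := h u; rewrite /= inE uJ orbT /r'' (negPf (nJ _ uJ)); apply.
  move=> [[Bw h] h']; split=> // u /=; rewrite inE /r''.
  by case: ifPn => [uU _|_ /= uJ]; [exact: (h u)|exact: (h' u)].
move=> ->; last first.
  by move=> u; rewrite inE => /orP[/Un->//|/Jn /ltnW].
congr (_ * _%:E)%E.
have UJ : perm_eq (enum_fset (U `|` J)%fset) (enum_fset U ++ enum_fset J).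
  apply: uniq_perm; first exact: fset_uniq.
    rewrite cat_uniq !fset_uniq andbT/=; apply/hasPn => u; exact: nJ.
  by move=> u; rewrite mem_cat inE.
rewrite (perm_big _ UJ)/= big_cat/=.
rewrite [X in X * _](prod_individuals_fset n z (fun u => p u.1.2 (r'' u))).
congr (_ * _).
  by apply: eq_big_seq => u uU; rewrite /r'' inE uU.
by apply: eq_big_seq => u uJ; rewrite /r'' (negPf (nJ _ uJ)).
Qed.

(** A separate forbidden set per generation lets one induction cover both a waiting period ([set0])
    and a window in which [A] is avoided. *)
Fixpoint avoiding (n : nat) (Cs : seq (set (typ d))) : set Omega :=
  if Cs is C :: Cs' then
    [set w | forall l, C l -> Z n w l = 0%N] `&` avoiding n.+1 Cs'
  else setT.

Definition avoiding_prob (Cs : seq (set (typ d))) : typ d -> R :=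
  foldr (fun C s => boundary_op p C (fun=> 0) s) (fun=> 1) Cs.

Lemma avoiding_prob_cube Cs : in_unit_cube (avoiding_prob Cs).
Proof.
elim: Cs => [|C Cs IH]; first exact: cube1.
exact: (cube_op_cube (boundary_operator hp C (@cube0 R d))).
Qed.

(** On [B] the census of generation [n] is [z]. Fixing all its offspring vectors gives a new known
    census and a new event independent of the future; summing over these vectors produces one [pgf]
    factor per individual. *)
Lemma avoiding_law i Cs n (z : offspring d) B : measurable B -> indep_future i n B ->
  (forall w, B w -> forall l, Z n w l = z l) ->
  measurable (B `&` avoiding n Cs) /\
  P i (B `&` avoiding n Cs) =
    (fine (P i B) * \prod_(l <- population_seq z) avoiding_prob Cs l)%:E.
Proof.
elim: Cs n z B => [|C Cs IH] n z B mB iB Bz.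
  by rewrite /= setIT big1_eq mulr1 fineK// fin_num_measure.
have [[l [Cl zl]]|Cz] := pselect (exists l, C l /\ (0 < z l)%N).
  have -> : B `&` avoiding n (C :: Cs) = set0.
    apply/seteqP; split=> // w [Bw [/= h _]].
    by move: zl; rewrite -(Bz w Bw) h.
  rewrite measure0; split=> //; congr EFin.
  rewrite -mem_population in zl.
  by rewrite (big_rem l zl)/= boundary_op_in// mul0r mulr0.
have -> : B `&` avoiding n (C :: Cs) = B `&` avoiding n.+1 Cs.
  apply/seteqP; split=> w [Bw]; first by move=> [].
  move=> h; split=> //; split=> // l Cl; rewrite (Bz w Bw).
  by apply/eqP; rewrite -leqn0 leqNgt; apply/negP => zl; apply: Cz; exists l.
have -> : \prod_(l <- population_seq z) avoiding_prob (C :: Cs) l =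
    \prod_(u <- individuals n z) pgf p u.1.2 (avoiding_prob Cs).
  rewrite (prod_individuals n z (fun j => pgf p j (avoiding_prob Cs))).
  apply: eq_big_seq => l; rewrite mem_population => zl /=.
  by rewrite boundary_op_out// => Cl; apply: Cz; exists l.
have v01 := avoiding_prob_cube Cs.
(* An offspring vector is weighted by its probability times that of its members complying with [Cs];
   these weights sum to the value of [pgf]. *)
pose wgt (u : label) r := p u.1.2 r * \prod_(l <- population_seq r) avoiding_prob Cs l.
apply: (@measure_peel _ _ _ _ _ (P i) (fun u => xi u.1.1 u.1.2 u.2) wgt _ [fsfun] _).
- exact: individuals_uniq.
- by apply: fine_ge0.
- move=> u r; rewrite mulr_ge0 ?(law_ge0 hp)//.
  by case/andP: (prod_cube (population_seq r) v01).
- by move=> u; rewrite pgf_esum.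
move=> r; have [iB' PB'] := indep_future_step z r iB.
set B' := B `&` _ in iB' PB' *.
have mB' : measurable B'.
  rewrite /B' -bigcap_individuals; apply: measurableI => //.
  rewrite bigcap_fset; apply: bigsetI_measurable => u _; exact: (xi_measurable hZ).
have [|mE PE] := IH n.+1 (progeny (individuals n z) r) B' mB' iB'.
  by move=> w [Bw /= h]; apply: generationS => // l; exact: Bz.
split=> //; rewrite PE PB' fineM ?fin_num_measure//= -mulrA; congr (_ * _)%:E.
by rewrite prod_progeny -big_split.
Qed.

End ProcessLaw.

(** * Extinction probabilities of the process *)

Section ExtinctionProbability.
Context {R : realType} {d : nat} {disp : measure_display}
  {Omega : measurableType disp}.
Context (p : typ d -> offspring d -> R) (P : typ d -> probability Omega R)
  (phi0 : Omega -> typ d) (xi : nat -> typ d -> nat -> Omega -> offspring d)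
  (hp : lower_hessenberg_law p) (hZ : branching_process p P phi0 xi).
Local Notation G := (fun s i => pgf p i s).
Local Notation Z := (generation phi0 xi).
Local Notation avoiding := (avoiding phi0 xi).
Implicit Types (A : set (typ d)) (Cs : seq (set (typ d))).

Lemma avoiding_start i Cs :
  measurable ([set w | phi0 w = i] `&` avoiding 0 Cs) /\
  P i ([set w | phi0 w = i] `&` avoiding 0 Cs) = (avoiding_prob p Cs i)%:E.
Proof.
pose z : offspring d := [fsfun l in [fset i]%fset => 1%N].
have [|mE PE] := avoiding_law hp hZ (i := i) (n := 0) Cs (z := z)
    (phi0_measurable hZ i) (indep_future_start hZ i).
  by move=> w /= wi l; rewrite /z fsfunE inE wi; case: (_ == _).
split=> //; rewrite PE (phi0_start hZ) mul1r -prod_population.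
rewrite (@big_fset_incl _ _ _ _ _ [fset i]%fset); last 2 first.
- by apply/fsubsetP => l; rewrite mem_finsupp /z fsfunE; case: ifP; rewrite ?eqxx.
- by move=> l _; rewrite memNfinsupp => /eqP ->.
by rewrite big_seq_fset1 /z fsfunE inE eqxx.
Qed.

Lemma avoiding_measurable Cs : measurable (avoiding 0 Cs).
Proof.
have -> : avoiding 0 Cs = \bigcup_i ([set w | phi0 w = i] `&` avoiding 0 Cs).
  by apply/seteqP; split=> [w wC|w [_ _ []]//]; exists (phi0 w).
apply: countable_bigcupT_measurable => [|i]; first exact: countableP.
by have [] := avoiding_start i Cs.
Qed.

Lemma avoidingP i Cs : P i (avoiding 0 Cs) = (avoiding_prob p Cs i)%:E.
Proof.
rewrite -(avoiding_start i Cs).2 probability1_setI//.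
- exact: (phi0_measurable hZ).
- exact: avoiding_measurable.
- exact: (phi0_start hZ).
Qed.

Definition avoiding_window A n m := avoiding 0 (nseq n set0 ++ nseq m A).

Lemma avoiding_windowE A n m : avoiding_window A n m =
  [set w | forall a, (n <= a < n + m)%N -> forall l, A l -> Z a w l = 0%N].
Proof.
have avA k : avoiding k (nseq m A) =
    [set w | forall a, (k <= a < k + m)%N -> forall l, A l -> Z a w l = 0%N].
  elim: m k => [|m IH] k /=.
    by apply/seteqP; split=> // w _ a; rewrite addn0 ltnNge andbN.
  rewrite IH; apply/seteqP; split=> w /=.
    move=> [h0 h] a /andP[]; rewrite leq_eqVlt => /orP[/eqP <-//|ka] am.
    by apply: h; rewrite ka addSnnS.
  move=> h; split; first by apply: h; rewrite leqnn -addSnnS leq_addr.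
  by move=> a /andP[ka am]; apply: h; rewrite (ltnW ka) -addSnnS.
have shift k : avoiding k (nseq n set0 ++ nseq m A) = avoiding (k + n) (nseq m A).
  elim: n k => [|n IH] k; first by rewrite addn0.
  rewrite /= IH addnS addSn; apply/seteqP; split=> w; first by case.
  by move=> ?; split.
by rewrite /avoiding_window shift add0n avA.
Qed.

Lemma avoiding_window_prob A n m i : P i (avoiding_window A n m) =
  (iter n G (iter m (boundary_op p A (fun=> 0)) (fun=> 1)) i)%:E.
Proof.
rewrite avoidingP /avoiding_prob foldr_cat; congr (_%:E).
have -> : foldr (fun C s => boundary_op p C (fun=> 0) s) (fun=> 1) (nseq m A) =
    iter m (boundary_op p A (fun=> 0)) (fun=> 1).
  by elim: m => //= m ->.
elim: n i => //= n IH i; rewrite boundary_op_out//.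
by congr pgf; apply/funext.
Qed.

Lemma extinction_event A : [set w | exists n : nat,
    (\sum_(n <= m <oo) \esum_(j in A) (Z m w j)%:R%:E = 0 :> \bar R)%E] =
  \bigcup_n \bigcap_m avoiding_window A n m.
Proof.
have ge0 w m : (0 <= \esum_(j in A) (Z m w j)%:R%:E :> \bar R)%E.
  by apply: esum_ge0 => j _; rewrite lee_fin.
apply/seteqP; split=> w /=.
  move=> [n sum0]; exists n => // m _; rewrite avoiding_windowE => a /andP[na am] l Al.
  have : (\esum_(j in A) (Z a w j)%:R%:E <= 0 :> \bar R)%E.
    rewrite -sum0; apply: le_trans (nneseries_lim_ge a.+1 _) => [|//].
    rewrite (big_cat_nat _ (n := a))//= big_nat1 leeDr//.
    exact: sume_ge0.
  have : ((Z a w l)%:R%:E <= \esum_(j in A) (Z a w j)%:R%:E :> \bar R)%E.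
    apply: esum_ge; exists [set l]; last by rewrite fsbig_set1.
    by split; [exact: finite_set1|move=> _ ->].
  move=> /le_trans/[apply]; rewrite lee_fin lern0 => /eqP//.
move=> [n _ h]; exists n; apply: eseries0 => m nm _.
(* The window of length [m.+1] starting at [n] contains generation [m]. *)
apply: esum1 => j Aj; have := h m.+1 I; rewrite avoiding_windowE => /(_ m) -> //.
by rewrite nm addnS ltnS leq_addl.
Qed.

(** Continuity of the measure is used twice: the windows decrease in their length [m], which yields
    [G^n(u)], and the resulting events increase in [n]. *)
Lemma extinctionE A i : extinction P phi0 xi A i = eventual_avoidance p A i.
Proof.
rewrite /extinction extinction_event.
have hA := boundary_operator hp A (@cube0 R d).
have mW n m : measurable (avoiding_window A n m) by exact: avoiding_measurable.
have mWn n : measurable (\bigcap_m avoiding_window A n m) by exact: bigcapT_measurable.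
have Pn n : P i (\bigcap_m avoiding_window A n m) = (iter n G (avoidance p A) i)%:E.
  have c1 : P i (avoiding_window A n m) @[m --> \oo] -->
      P i (\bigcap_m avoiding_window A n m).
    apply: nonincreasing_cvg_mu => //; first by rewrite ltey_eq fin_num_measure.
    move=> m m' mm'; apply/subsetPset; rewrite !avoiding_windowE => w h a /andP[na am].
    by apply: h; rewrite na (leq_trans am)// leq_add2l.
  have c2 : P i (avoiding_window A n m) @[m --> \oo] -->
      (iter n G (avoidance p A) i)%:E.
    under eq_cvg do rewrite avoiding_window_prob.
    apply: cvg_EFin; first by apply: nearW.
    have [u01 uc _ _] := greatest_fixpointP hA.
    elim: n i {c1} => [|n IH] i; first exact: uc.
    apply: (pgf_cvg hp) => [m||//]; apply: (iter_cube (pgf_operator hp)) => //.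
    by apply: (iter_cube hA); exact: cube1.
  by apply: (cvg_unique _ c1 c2).
have c1 : P i (\bigcap_m avoiding_window A n m) @[n --> \oo] -->
    P i (\bigcup_n \bigcap_m avoiding_window A n m).
  apply: nondecreasing_cvg_mu => //; first exact: bigcupT_measurable.
  move=> n n' nn'; apply/subsetPset => w h m _.
  rewrite avoiding_windowE => a /andP[na am].
  have := h (n' + m)%N I; rewrite avoiding_windowE; apply.
  by rewrite (leq_trans nn' na) (leq_trans am)// leq_addl.
have [_ qc _ _] := eventual_avoidanceP hp A.
have c2 : P i (\bigcap_m avoiding_window A n m) @[n --> \oo] -->
    (eventual_avoidance p A i)%:E.
  under eq_cvg do rewrite Pn.
  by apply: cvg_EFin; [apply: nearW|exact: qc].
by rewrite (cvg_unique _ c1 c2).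
Qed.

End ExtinctionProbability.

Theorem theorem5 (R : realType) (d : nat) (hd : (1 <= d)%N)
  (disp : measure_display) (Omega : measurableType disp)
  (p : typ d -> offspring d -> R) (P : typ d -> probability Omega R)
  (phi0 : Omega -> typ d) (xi : nat -> typ d -> nat -> Omega -> offspring d)
  (hp : lower_hessenberg_law p) (hZ : branching_process p P phi0 xi)
  (hirr : irreducible_law p)
  (A : set (typ d)) (hA : A !=set0)
  (hsing : infinite_set A \/ nonsingular_law p) :
  exists q : nat -> typ d -> R,
    (forall (k : nat) (i : typ d),
       modified_extinction p A k%:Z l%:Z i @[l --> \oo] --> q k i) /\
    (forall i : typ d,
       q k i @[k --> \oo] --> extinction P phi0 xi A i).
Proof.
exists (limit_modified p A); split=> [k i|i]; first exact: modified_extinction_cvg.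
rewrite (extinctionE hp hZ); exact: limit_modified_cvg.
Qed.
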